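(* Let $(B,\|\cdot\|)$ be a separable Banach space. The following five statements are equivalent: (i) $B$ is type 2. (ii) There is a constant $c\in(0,\infty)$ such that for all $X\in L$ and all $r>0$, $$ET_r\ge \frac{c}{h(r)}.$$ (iii) There is a constant $c\in(0,\infty)$ such that for all $X\in L$, all $r>0$ and all integers $n\ge 1$, $$P(T_r\le n)\le c\,n\,h(r).$$ (iv) There is a constant $c\in(0,\infty)$ such that for all $X\in L^2_0$, $$\liminf_{r\to\infty}\frac{ET_r}{r^2}\ge \frac{c}{E\|X\|^2}.$$ (v) There is a constant $c\in(0,\infty)$ such that for all $X\in L^2_0$, $$\limsup_{r\to\infty}\,\sup_{n\ge 1}\frac{r^2P(T_r\le n)}{n}\le c\,E\|X\|^2.$$ Moreover, the constants appearing in these statements may be taken to depend only on each other.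
   Context: $L$ denotes the collection of non-degenerate (i.e. not almost surely constant) $B$-valued random variables, $L^2=\{X\in L:E\|X\|^2<\infty\}$ and $L^2_0=\{X\in L^2:EX=0\}$. For $X\in L$ let $X_1,X_2,\dots$ be independent copies of $X$, $S_n=\sum_{j=1}^n X_j$, and for $r>0$ let $T_r=\min\{n\ge 1:\|S_n\|>r\}$. Write $E(Y;A)=E(Y\mathbf 1_A)$ (Bochner expectation when $Y$ is $B$-valued). For $r>0$ define $$G(r)=P(\|X\|>r),\quad K(r)=r^{-2}E(\|X\|^2;\|X\|\le r),\quad M(r)=r^{-1}E(X;\|X\|\le r),$$ $$h(r)=G(r)+K(r)+\|M(r)\|.$$ Both $T_r$ and $h$ depend on (the distribution of) $X$; the constants $c$ in the statements do not depend on $X$, $r$ or $n$. $B$ is type 2 if there is a constant $c\in(0,\infty)$ such that for every $n\ge1$ and every sequence of independent $B$-valued random variables $X_1,\dots,X_n$ with $EX_i=0$ and $E\|X_i\|^2<\infty$ for $1\le i\le n$, $$E\Big\|\sum_{i=1}^n X_i\Big\|^2\le c\sum_{i=1}^n E\|X_i\|^2;$$ any such $c$ is called a type 2 constant for $B$, and it is the constant associated with the statement ''$B$ is type 2''. ''The constants may be taken to depend only on each other'' means: if one of the statements holds with constant $c$, then each other statement holds with a constant that is determined by $c$ alone. *)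

(* Defs.v *)
From HB Require Import structures.
From mathcomp Require Import all_boot all_order all_algebra.
From mathcomp Require Import all_classical all_reals all_analysis.

Set Implicit Arguments.
Unset Strict Implicit.
Unset Printing Implicit Defensive.

Import Order.TTheory GRing.Theory Num.Theory.
Import numFieldNormedType.Exports.

Local Open Scope classical_set_scope.
Local Open Scope ring_scope.

Definition separable_space (T : topologicalType) : Prop :=
  exists2 D : set T, countable D & dense D.

Definition borel (B : topologicalType) : set (set B) := <<s @open B >>.

Section RandomElements.
Context {R : realType} {B : completeNormedModType R}.
Context d (T : measurableType d) (P : probability T R).
Implicit Types X Y : T -> B.

Definition random_element X : Prop :=
  forall A, borel A -> measurable (X @^-1` A).

Definition simple_element X : Prop :=
  random_element X /\ finite_set (range X).

Definition simple_expectation X : B :=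
  \sum_(b \in range X) fine (P (X @^-1` [set b])) *: b.

(* m is the Bochner integral of Y with respect to P; in particular Y is
   Bochner integrable. Borel measurability is used in place of strong
   measurability: the two agree when B is separable. *)
Definition has_expectation Y (m : B) : Prop :=
  random_element Y /\
  exists s : nat -> T -> B,
    [/\ forall k, simple_element (s k),
        'E_P[(fun w => `|Y w - s k w|)%R]%E @[k --> \oo] --> 0%E &
        simple_expectation (s k) @[k --> \oo] --> m].

(* The value 0 is used when Y is not Bochner integrable. *)
Definition bochner_expectation Y : B := xget 0 (has_expectation Y).

Definition independent (I : eqType) (Xs : I -> T -> B) : Prop :=
  forall (J : seq I) (A : I -> set B), uniq J -> (forall i, borel (A i)) ->
    P (\bigcap_(i in [set` J]) (Xs i @^-1` A i)) =
    (\big[*%E/1%E]_(i <- J) P (Xs i @^-1` A i))%E.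

Definition second_moment X : \bar R := 'E_P[(fun w => `|X w| ^+ 2)%R]%E.

Definition nonconstant X : Prop :=
  ~ exists b : B, {ae P, forall w, X w = b}.

(* Membership in the class L; in_L20 below is membership in L^2_0. *)
Definition in_L X : Prop := random_element X /\ nonconstant X.

Definition in_L20 X : Prop :=
  [/\ in_L X, (second_moment X < +oo)%E & has_expectation X 0].

Definition tailG X (r : R) : R := fine (P [set w | r < `|X w|]).

Definition truncK X (r : R) : R :=
  r ^- 2 * fine ('E_P[(fun w => `|X w| ^+ 2 * \1_[set w | `|X w| <= r] w)%R])%E.

Definition truncM X (r : R) : B :=
  r^-1 *: bochner_expectation
    (fun w => (\1_[set w | `|X w| <= r] w : R) *: X w).

Definition sumh X (r : R) : R := tailG X r + truncK X r + `|truncM X r|.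

(* The copies X_1, X_2, ... are Xs 0, Xs 1, ... *)
Definition psum (Xs : nat -> T -> B) (n : nat) : T -> B :=
  fun w => \sum_(j < n) Xs j w.

(* T_r, with value +oo where no partial sum leaves the ball. *)
Definition exit_time (Xs : nat -> T -> B) (r : R) : T -> \bar R :=
  fun w => ereal_inf
    [set n%:R%:E | n in [set n : nat | (1 <= n)%N /\ r < `|psum Xs n w|]].

Definition mean_exit_time (Xs : nat -> T -> B) (r : R) : \bar R :=
  (\int[P]_w exit_time Xs r w)%E.

Definition exit_prob (Xs : nat -> T -> B) (r : R) (n : nat) : \bar R :=
  P [set w | (exit_time Xs r w <= n%:R%:E)%E].

End RandomElements.

(* Xs is a sequence of independent copies of X; it may live on a probability
   space other than the one on which X is defined. *)
Definition iid_copies (R : realType) (B : completeNormedModType R)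
    d (T : measurableType d) (P : probability T R) (X : T -> B)
    d' (T' : measurableType d') (P' : probability T' R)
    (Xs : nat -> T' -> B) : Prop :=
  [/\ forall j, random_element (Xs j),
      forall j A, borel A -> P' (Xs j @^-1` A) = P (X @^-1` A) &
      independent P' Xs].

Section Statements.
Context {R : realType} (B : completeNormedModType R).

Definition type2 (c : R) : Prop :=
  forall d (T : measurableType d) (P : probability T R)
    (n : nat) (X : 'I_n -> T -> B),
    (1 <= n)%N ->
    (forall i, random_element (X i)) ->
    independent P X ->
    (forall i, has_expectation P (X i) 0) ->
    (forall i, second_moment P (X i) < +oo)%E ->
    (second_moment P (fun w => \sum_(i < n) X i w)%R <=
       c%:E * \sum_(i < n) second_moment P (X i))%E.

Definition exit_mean_bound (c : R) : Prop :=
  forall d (T : measurableType d) (P : probability T R) (X : T -> B)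
    d' (T' : measurableType d') (P' : probability T' R) (Xs : nat -> T' -> B),
    in_L P X -> iid_copies P X P' Xs ->
    forall r : R, 0 < r ->
      ((c / sumh P X r)%:E <= mean_exit_time P' Xs r)%E.

Definition exit_prob_bound (c : R) : Prop :=
  forall d (T : measurableType d) (P : probability T R) (X : T -> B)
    d' (T' : measurableType d') (P' : probability T' R) (Xs : nat -> T' -> B),
    in_L P X -> iid_copies P X P' Xs ->
    forall (r : R) (n : nat), 0 < r -> (1 <= n)%N ->
      (exit_prob P' Xs r n <= (c * n%:R * sumh P X r)%:E)%E.

Definition exit_mean_asymptotic_bound (c : R) : Prop :=
  forall d (T : measurableType d) (P : probability T R) (X : T -> B)
    d' (T' : measurableType d') (P' : probability T' R) (Xs : nat -> T' -> B),
    in_L20 P X -> iid_copies P X P' Xs ->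
    ((c / fine (second_moment P X))%:E <=
       limf_einf (fun r : R => mean_exit_time P' Xs r * (r ^- 2)%:E)
                 (pinfty_nbhs R))%E.

Definition exit_prob_asymptotic_bound (c : R) : Prop :=
  forall d (T : measurableType d) (P : probability T R) (X : T -> B)
    d' (T' : measurableType d') (P' : probability T' R) (Xs : nat -> T' -> B),
    in_L20 P X -> iid_copies P X P' Xs ->
    (limf_esup
       (fun r : R => ereal_sup [set (r ^+ 2 / n%:R)%:E * exit_prob P' Xs r n
                               | n in [set n : nat | (1 <= n)%N]])
       (pinfty_nbhs R)
     <= c%:E * second_moment P X)%E.

Definition statements : 5.-tuple (R -> Prop) :=
  [tuple type2; exit_mean_bound; exit_prob_bound;
         exit_mean_asymptotic_bound; exit_prob_asymptotic_bound].

End Statements.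

(* Main.v *)
Require Import Defs.
From mathcomp Require Import all_boot all_order all_algebra.
From mathcomp Require Import all_classical all_reals all_analysis.
From mathcomp Require Import perm finmap measurable_realfun ring lra.
Set Implicit Arguments.
Unset Strict Implicit.
Unset Printing Implicit Defensive.
Import Order.TTheory GRing.Theory Num.Theory.
Import numFieldNormedType.Exports.
Local Open Scope ring_scope.
Local Open Scope classical_set_scope.

(* Truncating and centring at level r, Ottaviani's maximal inequality together
   with type 2 bounds P(T_r <= n) by a multiple of n h(r), and this bounds E T_r
   from below. Since r^2 h(r) <= 2 E |X|^2 for centred X, the asymptotic
   statements follow.

   To return to type 2, let X be uniform on the letters +x_j, -x_j. A walk that
   survives in the ball of radius r for n + m steps survives n steps, and its
   increments then survive m steps in the ball of radius 2 r; hence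
   E T_r P(T_{2r} <= n) <= n, and a lower bound E T_r >= C r^2 gives the tail
   bound P(|S_n| > u) = O(n / u^2) and E |S_n| = O(sqrt n). Conditionally on the
   letters up to sign, S_n is a Rademacher sum whose j-th coefficient has mean
   absolute value at least sqrt (n / N) / 4, so that
   E |sum eps_j x_j| <= C' (sum |x_j|^2)^(1/2), and Kahane's inequality turns
   this into a second moment bound. Symmetrization gives type 2.

   All independence arguments take place on finite product spaces: separability
   allows every random element to be replaced by a finite-valued one. *)

(** Type 2 concerns summands with different laws, while the exit statements only speak of i.i.d.
    walks. A random letter drawn from all the vectors at once puts the whole family into one i.i.d.
    walk: after n steps each vector carries a coefficient of order sqrt (n / N), so the walk
    dominates that multiple of a Rademacher sum. The asymptotic statements are informative only
    beyond a radius that depends on the law, hence on the vectors. This does no harm: the upper and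
    the lower bound for E |S_n| both grow like sqrt n, so n can be chosen after that radius and
    cancels from the constant. A tail of order n / u^2 gives no second moment, since the layers
    would sum to a divergent series; it gives a first moment, and this is why Kahane's inequality
    has to enter. *)

Lemma eqW (R : porderType ring_display) (x y : R) : x = y -> x <= y.
Proof. by move=> ->. Qed.

(** * Uniform averages over words *)

Section WordAverage.
Context {R : realType} {F : finType}.
Implicit Types (g h : seq F -> R) (n m : nat).

(** Words are plain lists, with the length kept in the average: walks of lengths n and m can then be
    concatenated without casts, and every proof is an induction on the first letter. *)
Fixpoint wavg n g : R :=
  if n is n'.+1 then #|F|%:R^-1 * \sum_(a : F) wavg n' (fun s => g (a :: s))
  else g [::].

Lemma wavg_le n g h :
  (forall s, size s = n -> g s <= h s) -> wavg n g <= wavg n h.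
Proof.
elim: n g h => [|n IHn] g h gh /=; first exact: gh.
apply: ler_wpM2l; first by rewrite invr_ge0.
by apply: ler_sum => a _; apply: IHn => s ss; apply: gh; rewrite /= ss.
Qed.

Lemma eq_wavg n g h :
  (forall s, size s = n -> g s = h s) -> wavg n g = wavg n h.
Proof.
move=> gh; apply/eqP; rewrite eq_le.
by rewrite !wavg_le// => s /gh ->.
Qed.

Lemma wavg_ge0 n g : (forall s, 0 <= g s) -> 0 <= wavg n g.
Proof.
elim: n g => [|n IHn] g g0 /=; first exact: g0.
by rewrite mulr_ge0 ?invr_ge0 ?sumr_ge0// => a _; apply: IHn.
Qed.

Lemma wavgD n g h : wavg n (fun s => g s + h s) = wavg n g + wavg n h.
Proof.
elim: n g h => [|n IHn] g h //=.
by rewrite -mulrDr -big_split/=; under eq_bigr do rewrite IHn.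
Qed.

Lemma wavgZ n c g : wavg n (fun s => c * g s) = c * wavg n g.
Proof.
elim: n g => [|n IHn] g //=.
by rewrite mulrCA; under eq_bigr do rewrite IHn; rewrite -mulr_sumr.
Qed.

Lemma wavgB n g h : wavg n (fun s => g s - h s) = wavg n g - wavg n h.
Proof.
rewrite -mulN1r -wavgZ -wavgD.
by apply: eq_wavg => s _; rewrite mulN1r.
Qed.

Lemma wavg_sum n (I : Type) (r : seq I) (G : I -> seq F -> R) :
  wavg n (fun s => \sum_(i <- r) G i s) = \sum_(i <- r) wavg n (G i).
Proof.
elim: r => [|i r IHr].
  rewrite [RHS]big_nil; transitivity (wavg n (fun s : seq F => 0 * 0)).
    by apply: eq_wavg => s _; rewrite big_nil mul0r.
  by rewrite wavgZ mul0r.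
rewrite big_cons -IHr -wavgD.
by apply: eq_wavg => s _; rewrite big_cons.
Qed.

Lemma wavg_cat n m g :
  wavg (n + m) g = wavg n (fun s => wavg m (fun t => g (s ++ t))).
Proof.
elim: n g => [|n IHn] g //=.
by congr (_ * _); apply: eq_bigr => a _; rewrite IHn.
Qed.

(** An injection of a finite alphabet permutes it, so the uniform law on words is invariant. It is
    applied to sign flips and to transpositions of letters. *)
Lemma wavg_map (f : F -> F) n g :
  injective f -> wavg n (fun s => g (map f s)) = wavg n g.
Proof.
move=> injf; elim: n g => [|n IHn] g //=.
congr (_ * _); rewrite [RHS](reindex_inj injf)/=.
by apply: eq_bigr => a _; rewrite -(IHn (fun s => g (f a :: s))).
Qed.

Hypothesis F_gt0 : (0 < #|F|)%N.

Lemma wavg_cst n c : wavg n (fun=> c) = c.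
Proof.
elim: n => [|n IHn] //=; rewrite IHn sumr_const -(mulr_natl c) mulrA.
by rewrite mulVf ?mul1r// pnatr_eq0 -lt0n.
Qed.

Lemma wavg_sqr n g : wavg n g ^+ 2 <= wavg n (fun s => g s ^+ 2).
Proof.
have : 0 <= wavg n (fun s => (g s - wavg n g) ^+ 2).
  by apply: wavg_ge0 => s; exact: sqr_ge0.
rewrite (_ : wavg n _ = wavg n (fun s => g s ^+ 2) - wavg n g ^+ 2) ?subr_ge0//.
transitivity (wavg n (fun s => (g s ^+ 2 - (2 * wavg n g) * g s)
                               + wavg n g ^+ 2)).
  by apply: eq_wavg => s _; ring.
rewrite wavgD wavgB wavgZ wavg_cst; ring.
Qed.

End WordAverage.

Lemma wavg_exchange (R : realType) (F H : finType) n m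
    (G : seq F -> seq H -> R) :
  wavg n (fun s => wavg m (G s)) = wavg m (fun t => wavg n (G^~ t)).
Proof.
elim: n G => [|n IHn] G //=; rewrite wavgZ wavg_sum.
by congr (_ * _); apply: eq_bigr => a _; rewrite IHn.
Qed.

(** * The Khintchine-Kahane inequality *)

Section Kahane.
Context {R : realType}.
Implicit Types (f g h : seq bool -> R) (n : nat).

Let bool_gt0 : (0 < #|{: bool}|)%N. Proof. by rewrite card_bool. Qed.

Lemma wavg_bool n f : wavg n.+1 f =
  (wavg n (fun s => f (true :: s)) + wavg n (fun s => f (false :: s))) / 2.
Proof. by rewrite /= card_bool big_bool mulrC. Qed.

(** The adjacency operator of the discrete cube: the neighbours of s arise by flipping one
    letter. *)
Fixpoint flipsum (V : zmodType) (f : seq bool -> V) (s : seq bool) : V :=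
  if s is b :: s' then f (~~ b :: s') + flipsum (fun t => f (b :: t)) s' else 0.

Lemma flipsumD f g s :
  flipsum (fun t => f t + g t) s = flipsum f s + flipsum g s.
Proof.
elim: s f g => [|b s IHs] f g /=; first by rewrite addr0.
by rewrite IHs addrACA.
Qed.

Lemma flipsumB f g s :
  flipsum (fun t => f t - g t) s = flipsum f s - flipsum g s.
Proof.
elim: s f g => [|b s IHs] f g /=; first by rewrite subr0.
by rewrite IHs; ring.
Qed.

(** The energy of the graph Laplacian of the cube, which multiplies a Walsh function of degree k by
    2 k. *)
Definition dirichlet n f := wavg n (fun s => f s * (n%:R * f s - flipsum f s)).

Definition even_part f s := (f (true :: s) + f (false :: s)) / 2.
Definition odd_part f s := (f (true :: s) - f (false :: s)) / 2.

(** With the first letter as a sign, f is the even part plus or minus the odd part. Flipping that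
    letter negates the odd term, whence the extra energy; the other flips act on each part, and the
    cross terms cancel in the average over the first letter. *)
Lemma dirichletS n f : dirichlet n.+1 f =
  dirichlet n (even_part f) + dirichlet n (odd_part f)
  + 2 * wavg n (fun s => odd_part f s ^+ 2).
Proof.
rewrite /dirichlet wavg_bool -wavgZ -!wavgD mulrC -wavgZ.
apply: eq_wavg => s _ /=.
have E : flipsum (fun t => f (true :: t)) s =
    flipsum (even_part f) s + flipsum (odd_part f) s.
  rewrite -flipsumD; congr flipsum; apply/funext => t.
  by rewrite /even_part /odd_part; field.
have O : flipsum (fun t => f (false :: t)) s =
    flipsum (even_part f) s - flipsum (odd_part f) s.
  rewrite -flipsumB; congr flipsum; apply/funext => t.
  by rewrite /even_part /odd_part; field.
by rewrite E O /even_part /odd_part -natr1; field.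
Qed.

Lemma wavg_even_part n f : wavg n (even_part f) = wavg n.+1 f.
Proof.
rewrite wavg_bool -wavgD mulrC -wavgZ.
by apply: eq_wavg => s _; rewrite /even_part mulrC.
Qed.

Lemma wavg_sqr_parts n f : wavg n.+1 (fun s => f s ^+ 2) =
  wavg n (fun s => even_part f s ^+ 2) + wavg n (fun s => odd_part f s ^+ 2).
Proof.
rewrite wavg_bool -!wavgD mulrC -wavgZ.
by apply: eq_wavg => s _; rewrite /even_part /odd_part; field.
Qed.

(** Induction on the dimension: the even part inherits the variance, and the square of the odd part
    is paid by the energy of the first flip. Jensen's inequality enters to make the energy of the
    odd part nonnegative. *)
Lemma poincare n f :
  2 * (wavg n (fun s => f s ^+ 2) - wavg n f ^+ 2) <= dirichlet n f.
Proof.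
elim: n f => [|n IHn] f.
  by rewrite /dirichlet /= mul0r !subrr !mulr0.
rewrite dirichletS wavg_sqr_parts -wavg_even_part.
have := IHn (even_part f); have := IHn (odd_part f).
have := wavg_sqr bool_gt0 n (odd_part f).
set a := wavg n _; set b := wavg n _; set c := wavg n _; set d := wavg n _.
lra.
Qed.

(* The squared weight of f on the Walsh functions of degree one. *)
Fixpoint level1 n f : R :=
  if n is n'.+1 then wavg n' (odd_part f) ^+ 2 + level1 n' (even_part f) else 0.

(** Walsh functions of degree at least 2 have energy at least 4; those of degree one have energy 2
    and are compensated by [level1]. In the induction the odd part already has one degree from the
    first letter, so the plain gap suffices for it. *)
Lemma poincare_level1 n f :
  4 * (wavg n (fun s => f s ^+ 2) - wavg n f ^+ 2)
  <= dirichlet n f + 2 * level1 n f.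
Proof.
elim: n f => [|n IHn] f.
  by rewrite /dirichlet /= mul0r !subrr !mulr0 addr0.
rewrite dirichletS wavg_sqr_parts -wavg_even_part /=.
have := IHn (even_part f); have := poincare n (odd_part f); lra.
Qed.

(** If f is even, its odd part in the first letter is an odd function of the remaining letters and
    averages to 0, while the even part is even again. *)
Lemma level1_even n f :
  (forall s, size s = n -> f (map negb s) = f s) -> level1 n f = 0.
Proof.
elim: n f => [|n IHn] f fE //=.
rewrite IHn; last first.
  move=> s ss; rewrite /even_part addrC.
  have := fE (true :: s); have := fE (false :: s).
  by rewrite /= ss => -> // ->.
suff E : wavg n (odd_part f) = - wavg n (odd_part f).
  have -> : wavg n (odd_part f) = 0 by move: E; lra.
  by rewrite expr0n addr0.
rewrite -{1}(wavg_map n (odd_part f) (can_inj negbK)) -mulN1r -wavgZ.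
apply: eq_wavg => s ss; rewrite /odd_part.
have := fE (true :: s); have := fE (false :: s).
by rewrite /= ss => -> // -> //; ring.
Qed.

Context {V : normedModType R}.

Definition signed_sum n (x : 'I_n -> V) (s : seq bool) : V :=
  \sum_(i < n) (-1) ^+ (nth false s i) *: x i.

Lemma signed_sumS n (x : 'I_n.+1 -> V) b s : signed_sum x (b :: s) =
  (-1) ^+ b *: x ord0 + signed_sum (fun i => x (lift ord0 i)) s.
Proof. by rewrite /signed_sum big_ord_recl. Qed.

(** Flipping letter i removes twice the i-th term, so the n flips together remove twice the sum. The
    offset c carries the letters already read in the induction. *)
Lemma flipsum_signed_sum n (x : 'I_n -> V) (c : V) s : size s = n ->
  flipsum (fun t => c + signed_sum x t) s =
  (c + signed_sum x s) *+ n - signed_sum x s *+ 2.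
Proof.
elim: n x c s => [|n IHn] x c [|b s] //= ss.
  by rewrite mulr0n /signed_sum big_ord0 mul0rn subrr.
under [X in _ + flipsum X _]eq_fun do rewrite signed_sumS addrA.
rewrite IHn; last by case: ss.
rewrite !signed_sumS; set r := signed_sum _ s.
have -> : (-1) ^+ (~~ b) *: x ord0 = - ((-1) ^+ b *: x ord0).
  by case: b {ss} => /=; rewrite ?expr0 ?expr1 scaleN1r scale1r ?opprK.
set u := _ *: _; rewrite [X in _ = X - _]mulrS ![c + (u + r)]addrA.
set A := _ *+ n; clearbody u r A.
rewrite mulrnDl !mulr2n !opprD !addrA.
by rewrite [RHS](ACl (1*5*3*4*7*8*2*6))/= addrK.
Qed.

Lemma norm_flipsum (f : seq bool -> V) s :
  `|flipsum f s| <= flipsum (fun t => `|f t|) s.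
Proof.
elim: s f => [|b s IHs] f /=; first by rewrite normr0.
by rewrite (le_trans (ler_normD _ _))// lerD2l IHs.
Qed.

(* Averaging over the coordinate flips of s leaves (n - 2) times the sum, so by
   convexity f = |signed_sum x| satisfies n f - flipsum f <= 2 f; as f is even,
   its first Walsh level vanishes, and the spectral gap doubles. *)
Lemma khintchine_kahane n (x : 'I_n -> V) :
  wavg n (fun s => `|signed_sum x s| ^+ 2)
  <= 2 * wavg n (fun s => `|signed_sum x s|) ^+ 2.
Proof.
set f := fun s => `|signed_sum x s|.
have fE s : size s = n -> f (map negb s) = f s.
  move=> ss; rewrite /f -normrN; congr `|_|.
  rewrite /signed_sum -sumrN; apply: eq_bigr => i _.
  rewrite -scaleNr (nth_map false) ?ss//.
  by case: nth; rewrite ?expr0 ?expr1 ?opprK.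
have := poincare_level1 n f; rewrite level1_even//.
suff : dirichlet n f <= 2 * wavg n (fun s => f s ^+ 2) by lra.
rewrite -wavgZ; apply: wavg_le => s ss.
suff : n%:R * f s - flipsum f s <= 2 * f s.
  by move=> /(ler_wpM2r (normr_ge0 (signed_sum x s))); rewrite -/(f s); lra.
have := norm_flipsum (fun t => 0 + signed_sum x t) s.
rewrite flipsum_signed_sum// add0r.
under [X in flipsum X _]eq_fun do rewrite add0r.
rewrite -/(f _) => H.
(* Written without the factor n - 2, the triangle inequality also covers n < 2. *)
have : `|signed_sum x s *+ n| <= flipsum f s + `|signed_sum x s *+ 2|.
  rewrite -[X in `|X|](subrK (signed_sum x s *+ 2)).
  by rewrite (le_trans (ler_normD _ _))// lerD2r.
rewrite !normrMn -/(f s) -[_ *+ n]mulr_natl -[_ *+ 2]mulr_natl; lra.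
Qed.

End Kahane.

(** * Random words *)

Section WordSums.
Context {R : realType} {F : finType}.
Hypothesis F_gt0 : (0 < #|F|)%N.
Implicit Types (n m : nat) (s t : seq F).

Local Notation mean f := (#|F|%:R^-1 * \sum_(a : F) f a).

(** A polynomial minorant of the absolute value: averaging it bounds a first absolute moment below
    by the second and fourth moments. Here s stands for the square root of the second moment. *)
Lemma abs_ge_quartic (t s : R) : 0 < s ->
  (t ^+ 2 / s - t ^+ 4 / (8 * s ^+ 3)) / 2 <= `|t|.
Proof.
move=> s0; have := normr_ge0 t; rewrite -(real_normK (num_real t)).
have -> : t ^+ 4 = `|t| ^+ 4 by rewrite -normrX ger0_norm// exprn_even_ge0.
move: `|t| => {}t t0.
have -> : (t ^+ 2 / s - t ^+ 4 / (8 * s ^+ 3)) / 2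
        = t * ((8 * t * s ^+ 2 - t ^+ 3) / (16 * s ^+ 3)).
  by field; rewrite gt_eqF.
rewrite ler_piMr// ler_pdivrMr; last by rewrite mulr_gt0// exprn_gt0.
rewrite mul1r -subr_ge0.
have -> : 16 * s ^+ 3 - (8 * t * s ^+ 2 - t ^+ 3)
        = (t - 2 * s) ^+ 2 * (t + 4 * s) + 4 * t * s ^+ 2 by ring.
apply: addr_ge0; apply: mulr_ge0; rewrite ?sqr_ge0//; lra.
Qed.

Section Moments.
Variables (xi : F -> R) (p : R).
Hypotheses (xi1 : mean xi = 0) (xi2 : mean (fun a => xi a ^+ 2) = p)
  (xi3 : mean (fun a => xi a ^+ 3) = 0) (xi4 : mean (fun a => xi a ^+ 4) = p).

Let W s := \sum_(a <- s) xi a.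

Lemma second_moment_word n : wavg n (fun s => W s ^+ 2) = n%:R * p.
Proof.
elim: n => [|n IHn]; first by rewrite /= /W big_nil expr0n mul0r.
transitivity (mean (fun a => xi a ^+ 2) + 2 * mean xi * wavg n W
              + wavg n (fun s => W s ^+ 2)); last first.
  by rewrite xi1 xi2 IHn -natr1; ring.
rewrite -[wavg n (fun s => W s ^+ 2)](wavg_cst F_gt0 1) /=.
rewrite mulrCA -!mulrA -!mulrDr; congr (_ * _).
rewrite mulr_suml mulr_sumr -!big_split/=; apply: eq_bigr => a _.
rewrite -[xi a ^+ 2](wavg_cst F_gt0 n) -!wavgZ -!wavgD.
by apply: eq_wavg => s _; rewrite /W big_cons; ring.
Qed.

(** The hypotheses on [xi] are the moments of a letter with values -1, 0, 1: the even ones equal p,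
    the odd ones vanish. Hence only the n fourth powers and the 3 n (n - 1) products of two squares
    survive. *)
Lemma fourth_moment_word n :
  wavg n (fun s => W s ^+ 4) = n%:R * p + 3 * n%:R * (n%:R - 1) * p ^+ 2.
Proof.
elim: n => [|n IHn]; first by rewrite /= /W big_nil expr0n/=; ring.
transitivity (mean (fun a => xi a ^+ 4)
  + 4 * mean (fun a => xi a ^+ 3) * wavg n W
  + 6 * mean (fun a => xi a ^+ 2) * wavg n (fun s => W s ^+ 2)
  + 4 * mean xi * wavg n (fun s => W s ^+ 3)
  + wavg n (fun s => W s ^+ 4)); last first.
  by rewrite xi1 xi2 xi3 xi4 IHn second_moment_word -natr1; ring.
rewrite -[wavg n (fun s => W s ^+ 4)](wavg_cst F_gt0 1) /=.
rewrite ![_ * (_^-1 * _)]mulrCA -!mulrA -!mulrDr; congr (_ * _).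
rewrite !mulr_suml !mulr_sumr -!big_split/=; apply: eq_bigr => a _.
rewrite -[xi a ^+ 4](wavg_cst F_gt0 n) -!wavgZ -!wavgD.
by apply: eq_wavg => s _; rewrite /W big_cons; ring.
Qed.

(** Once n p is at least 1, the fourth moment is at most 4 (n p)^2, and the quartic minorant keeps
    half of its leading term. *)
Lemma first_abs_moment_word n : 1 <= n%:R * p ->
  Num.sqrt (n%:R * p) / 4 <= wavg n (fun s => `|W s|).
Proof.
move=> np; set s := Num.sqrt _.
have s2 : s ^+ 2 = n%:R * p by rewrite sqr_sqrtr// (le_trans _ np).
have s0 : 0 < s by rewrite sqrtr_gt0 (lt_le_trans _ np).
apply: (@le_trans _ _ (wavg n (fun t => (2 * s)^-1 * W t ^+ 2
    - (16 * s ^+ 3)^-1 * W t ^+ 4))); last first.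
  apply: wavg_le => t _; apply: le_trans (abs_ge_quartic (W t) s0).
  by apply/eqW; field; rewrite gt_eqF.
rewrite wavgB !wavgZ second_moment_word fourth_moment_word.
have : n%:R * p + 3 * n%:R * (n%:R - 1) * p ^+ 2 <= 4 * s ^+ 4.
  have p0 : 0 <= n%:R * p ^+ 2 by rewrite mulr_ge0// sqr_ge0.
  rewrite -[4%N]/(2 * 2)%N exprM s2.
  move: np p0; set q := n%:R; nra.
move=> H; rewrite -s2.
apply: (@le_trans _ _ ((2 * s)^-1 * s ^+ 2 - (16 * s ^+ 3)^-1 * (4 * s ^+ 4))).
  by apply/eqW; field; rewrite gt_eqF.
rewrite lerD2l lerN2 ler_wpM2l// ?s2//.
by rewrite invr_ge0 mulr_ge0// exprn_ge0// ltW.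
Qed.
End Moments.

(** Dyadic layers above a: the i-th has width a 2^i and probability at most D / (a 2^i)^2, so the
    layers sum geometrically to 2 D / a. The bound M makes the number of layers finite. *)
Lemma wavg_layer_cake n (g : seq F -> R) (a D M : R) : 0 < a ->
  (forall s, size s = n -> g s <= M) ->
  (forall u, a <= u -> wavg n (fun s => (u < g s)%R%:R) <= D / u ^+ 2) ->
  wavg n g <= a + 2 * D / a.
Proof.
move=> a0 gM gD.
have D0 : 0 <= D.
  have := le_trans (wavg_ge0 n (fun s => ler0n R (a < g s)%R)) (gD _ (lexx a)).
  by rewrite pmulr_lge0// invr_gt0 exprn_gt0.
have a2 j : a <= a * 2 ^+ j by rewrite ler_peMr ?exprn_ege1 ?ler1n ?(ltW a0).
pose J := (Num.truncn (M / a)).+1.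
have MJ : M <= a * 2 ^+ J.
  rewrite mulrC -ler_pdivrMr//; apply: ltW; apply: lt_trans (truncnS_gt _) _.
  by rewrite -natrX ltr_nat ltn_expl.
have dyadic j x : x <= a * 2 ^+ j ->
    x <= a + \sum_(i < j) a * 2 ^+ i * (a * 2 ^+ i < x)%R%:R.
  elim: j => [|j IHj] xj; first by rewrite big_ord0 addr0 -[a]mulr1.
  case: (leP x (a * 2 ^+ j)) => [/IHj|jx].
    move=> H; rewrite big_ord_recr/= (le_trans H)// addrA lerDl.
    by rewrite mulr_ge0// mulr_ge0// ?ltW// exprn_ge0.
  apply: (le_trans xj).
  have -> : \sum_(i < j.+1) a * 2 ^+ i * (a * 2 ^+ i < x)%R%:R =
            \sum_(i < j.+1) a * 2 ^+ i.
    apply: eq_bigr => i _; rewrite (_ : (_ < x) = true) ?mulr1//.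
    apply: le_lt_trans jx; rewrite ler_pM2l// ler_eXn2l// ?ltr1n//.
    by rewrite -ltnS.
  rewrite -mulr_sumr -(ler_pM2l (_ : 0 < a^-1)) ?invr_gt0//.
  rewrite mulrDr !mulKf ?gt_eqF// mulVf ?gt_eqF//.
  have := subrX1 2 j.+1 :> (_ : R) = _; rewrite (_ : 2 - 1 = 1) ?mul1r//; last by ring.
  lra.
apply: (@le_trans _ _ (wavg n (fun s => a + \sum_(i < J) a * 2 ^+ i
    * (a * 2 ^+ i < g s)%R%:R))).
  by apply: wavg_le => s ss; apply: dyadic; exact: le_trans (gM _ ss) _.
rewrite wavgD wavg_cst// lerD2l wavg_sum.
apply: (@le_trans _ _ (\sum_(i < J) (D / a) * 2^-1 ^+ i)).
  apply: ler_sum => i _; rewrite wavgZ.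
  apply: (@le_trans _ _ (a * 2 ^+ i * (D / (a * 2 ^+ i) ^+ 2))).
    by rewrite ler_wpM2l ?gD// mulr_ge0// ?ltW// exprn_ge0.
  rewrite exprVn le_eqVlt; apply/orP; left; apply/eqP.
  by field; rewrite expf_neq0//= gt_eqF.
rewrite -mulr_sumr [leRHS](_ : _ = D / a * 2); last by ring.
apply: ler_wpM2l; first by rewrite divr_ge0// ltW.
have := subrX1 (2^-1 : R) J.
have : 0 <= (2^-1 : R) ^+ J by rewrite exprn_ge0.
lra.
Qed.

End WordSums.

(** * Walks confined to a ball *)

Section Stay.
Context {R : realType} {V : normedModType R} {F : finType}.
Hypothesis F_gt0 : (0 < #|F|)%N.
Variable y : F -> V.
Implicit Types (n m : nat) (s t : seq F) (r : R) (c : V).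

Fixpoint stay r c s : bool :=
  if s is a :: s' then (`|c + y a| <= r) && stay r (c + y a) s' else true.

Lemma stay_cat r c s t :
  stay r c (s ++ t) = stay r c s && stay r (c + \sum_(a <- s) y a) t.
Proof.
elim: s c => [|a s IHs] c /=; first by rewrite big_nil addr0.
by rewrite IHs big_cons addrA andbA.
Qed.

Lemma stay_shift r c d s : `|c| <= r -> stay r (c + d) s -> stay (2 * r) d s.
Proof.
move=> cr; elim: s d => [|a s IHs] d //=.
rewrite -addrA => /andP[cda /IHs ->]; rewrite andbT.
rewrite -[d + y a](addKr c) (le_trans (ler_normD _ _))// normrN.
by rewrite mulr_natl mulr2n lerD.
Qed.

Lemma stay_norm r s : 0 <= r -> stay r 0 s -> `|\sum_(a <- s) y a| <= r.
Proof.
elim/last_ind: s => [|s a _] r0; first by rewrite big_nil normr0.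
rewrite -cats1 stay_cat add0r big_cat big_seq1 /= andbT.
by case/andP.
Qed.

Lemma wavg_stay_cat r n m : 0 <= r ->
  wavg (n + m) (fun s => (stay r 0 s)%:R) <=
  wavg n (fun s => (stay r 0 s)%:R) * wavg m (fun s => (stay (2 * r) 0 s)%:R)
  :> R.
Proof.
move=> r0; rewrite wavg_cat mulrC -wavgZ; apply: wavg_le => s _.
rewrite mulrC -wavgZ; apply: wavg_le => t _.
rewrite stay_cat add0r; case: (boolP (stay r 0 s)) => [rs|_] /=; last first.
  by rewrite mul0r.
rewrite mul1r ler_nat; case: (boolP (stay r _ t)) => // rt.
have := stay_shift (stay_norm r0 rs); rewrite -[\sum_(_ <- s) _]addr0 in rt.
by move=> /(_ _ _ rt) ->.
Qed.

(** Every block contributes the same factor at radius 2 r, since the whole walk is back in the ball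
    of radius r at the start of each block. *)
Lemma wavg_stay_iter r n k : 0 <= r ->
  wavg (k * n) (fun s => (stay r 0 s)%:R) <=
  wavg n (fun s => (stay (2 * r) 0 s)%:R) ^+ k :> R.
Proof.
move=> r0; elim: k => [|k IHk]; first by rewrite mul0n.
rewrite mulSnr (le_trans (wavg_stay_cat _ _ r0))// exprSr.
by rewrite ler_wpM2r// wavg_ge0.
Qed.

End Stay.

(** * Words of signed letters against Rademacher sums *)

Section SignedLetters.
Context {R : realType} {V : normedModType R}.
Implicit Types (N n : nat).

(** The average contains both signs of each term, so replacing a coefficient by its absolute value
    merely exchanges the two halves. The offset c carries the induction. *)
Lemma wavg_signed_abs N (x : 'I_N -> V) (a : 'I_N -> R) (c : V) :
  wavg N (fun d => `|c + signed_sum (fun j => a j *: x j) d|) =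
  wavg N (fun d => `|c + signed_sum (fun j => `|a j| *: x j) d|).
Proof.
elim: N x a c => [|N IHN] x a c.
  by rewrite /= /signed_sum !big_ord0.
rewrite !wavg_bool.
have E (a' : 'I_N.+1 -> R) b :
    wavg N (fun s => `|c + signed_sum (fun j => a' j *: x j) (b :: s)|) =
    wavg N (fun s => `|(c + (-1) ^+ b *: (a' ord0 *: x ord0))
      + signed_sum (fun j => `|a' (lift ord0 j)| *: x (lift ord0 j)) s|).
  rewrite -IHN; apply: eq_wavg => s _.
  by rewrite signed_sumS addrA.
rewrite !E /= expr0 expr1 !scale1r !scaleN1r.
have absE d : wavg N (fun s => `|d
      + signed_sum (fun j => `|a (lift ord0 j)| *: x (lift ord0 j)) s|) =
    wavg N (fun s => `|d
      + signed_sum (fun j => `|(`|a (lift ord0 j)|)| *: x (lift ord0 j)) s|).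
  apply: eq_wavg => s _; rewrite /signed_sum.
  by under [in RHS]eq_bigr do rewrite normr_id.
rewrite -!absE; have [a0|a0] := leP 0 (a ord0).
  by rewrite ger0_norm.
by rewrite ltr0_norm// scaleNr opprK [X in X / _]addrC.
Qed.

Lemma norm_sum_wavg_le (F : finType) n m (r : 'I_m -> seq F -> R)
    (z : 'I_m -> V) :
  `|\sum_j wavg n (r j) *: z j| <= wavg n (fun s => `|\sum_j r j s *: z j|).
Proof.
elim: n r => [|n IHn] r //=.
under eq_bigr do rewrite -scalerA scaler_suml.
rewrite -scaler_sumr exchange_big/= normrZ ger0_norm ?invr_ge0//.
rewrite ler_wpM2l ?invr_ge0// (le_trans (ler_norm_sum _ _ _))//.
by apply: ler_sum => a _; apply: IHn.
Qed.

Section Letters.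
Variables (N : nat) (x : 'I_N -> V).
Hypothesis N_gt0 : (0 < N)%N.

Definition letter (a : 'I_N * bool) : V := (-1) ^+ a.2 *: x a.1.

Definition signed_count (j : 'I_N) (s : seq ('I_N * bool)) : R :=
  \sum_(a <- s) (a.1 == j)%:R * (-1) ^+ a.2.

Lemma card_letters : #|{: 'I_N * bool}| = (N * 2)%N.
Proof. by rewrite card_prod card_ord card_bool. Qed.

Lemma letters_gt0 : (0 < #|{: 'I_N * bool}|)%N.
Proof. by rewrite card_letters muln_gt0 N_gt0. Qed.

Lemma sum_letters (s : seq ('I_N * bool)) :
  \sum_(a <- s) letter a = \sum_j signed_count j s *: x j.
Proof.
under [RHS]eq_bigr do rewrite scaler_suml.
rewrite exchange_big/=; apply: eq_bigr => a _.
rewrite (bigD1 a.1)//= eqxx mul1r big1 ?addr0// => j /negbTE.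
by rewrite eq_sym => ->; rewrite mul0r scale0r.
Qed.

Lemma mean_letters (f : 'I_N -> bool -> R) (j : 'I_N) :
  (forall i b, i != j -> f i b = 0) ->
  #|{: 'I_N * bool}|%:R^-1 * \sum_a f a.1 a.2 =
  (f j true + f j false) / (2 * N%:R).
Proof.
move=> f0; rewrite card_letters natrM mulrC [N%:R * _]mulrC; congr (_ / _).
rewrite -(pair_bigA _ (fun i b => f i b))/= (bigD1 j)//= big_bool.
rewrite big1 ?addr0; first by [].
by move=> i ij; rewrite big_bool /= (f0 i true ij) (f0 i false ij) add0r.
Qed.

(** The contribution of one letter to the count of j is 0 or a sign, with p = 1 / N; the condition N
    <= n is n p >= 1. *)
Lemma abs_signed_count_ge n j : (N <= n)%N ->
  Num.sqrt (n%:R / N%:R) / 4 <= wavg n (fun s => `|signed_count j s|).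
Proof.
move=> Nn; have N0 : 0 < N%:R :> R by rewrite ltr0n.
have nz : 2 * N%:R != 0 :> R by rewrite mulf_neq0// gt_eqF.
(* This is 1 / N for even exponents and 0 for odd ones. *)
have M k : #|{: 'I_N * bool}|%:R^-1 *
    (\sum_(a : 'I_N * bool) ((a.1 == j)%:R * (-1) ^+ a.2) ^+ k.+1) =
    (((-1) ^+ k.+1 + 1) / (2 * N%:R) : R).
  rewrite (@mean_letters (fun i b => ((i == j)%:R * (-1) ^+ b) ^+ k.+1) j).
    by rewrite eqxx /= !mul1r expr1 expr0 expr1n.
  by move=> i b /negbTE ->; rewrite mul0r expr0n.
apply: (first_abs_moment_word letters_gt0).
- by rewrite -[RHS](mul0r (2 * N%:R)^-1) -[X in X / _](addNr 1) -(M 0%N).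
- by rewrite (M 1%N); field; rewrite gt_eqF.
- by rewrite (M 2%N) exprS sqrrN expr1n mulr1 addNr mul0r.
- by rewrite (M 3%N) (exprM _ 2 2) sqrrN !expr1n; field; rewrite gt_eqF.
- by rewrite ler_pdivlMr// mul1r ler_nat.
Qed.

Lemma abs_signed_count_eq n i j :
  wavg n (fun s => `|signed_count i s|) = wavg n (fun s => `|signed_count j s|).
Proof.
pose f (a : 'I_N * bool) := (tperm i j a.1, a.2).
have injf : injective f by case=> a b [c d] [/perm_inj -> ->].
rewrite -[RHS](wavg_map _ _ injf); apply: eq_wavg => s _.
rewrite /signed_count big_map; congr `|_|; apply: eq_bigr => a _ /=.
by rewrite -(inj_eq (@perm_inj _ (tperm i j)) a.1 i) tpermL.
Qed.

(** A contraction argument. Flipping the letters by an independent sign pattern d preserves their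
    law and turns the walk into a signed sum with coefficients [signed_count]; these may be replaced
    by their absolute values. For fixed d, Jensen's inequality then replaces each by its mean, which
    is the same for all j and factors out. *)
Lemma signed_sum_le_word n : (N <= n)%N ->
  Num.sqrt (n%:R / N%:R) / 4 * wavg N (fun d => `|signed_sum x d|)
  <= wavg n (fun s => `|\sum_(a <- s) letter a|).
Proof.
move=> Nn.
(* The relabelling that flips the sign of every letter with index j whenever d has a flip at j. *)
pose f (d : seq bool) (a : 'I_N * bool) := (a.1, a.2 (+) nth false d a.1).
have injf d : injective (f d).
  by move=> [a b] [a' b'] [<-] /addIb ->.
have flip d s : \sum_(a <- map (f d) s) letter a =
    signed_sum (fun j => signed_count j s *: x j) d.
  rewrite sum_letters /signed_sum; apply: eq_bigr => j _.
  rewrite scalerA; congr (_ *: _); rewrite /signed_count big_map mulr_sumr.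
  apply: eq_bigr => -[i b] _ /=.
  case: (eqVneq i j) => [->|]; last by rewrite !mul0r mulr0.
  by rewrite !mul1r signr_addb mulrC.
have -> : wavg n (fun s => `|\sum_(a <- s) letter a|) =
    wavg N (fun d => wavg n (fun s =>
      `|signed_sum (fun j => `|signed_count j s| *: x j) d|)).
  rewrite wavg_exchange.
  transitivity (wavg n (fun s => wavg N (fun d =>
      `|0 + signed_sum (fun j => signed_count j s *: x j) d|))); last first.
    apply: eq_wavg => s _; rewrite wavg_signed_abs.
    by apply: eq_wavg => d _; rewrite add0r.
  rewrite wavg_exchange -[LHS](@wavg_cst _ bool _ N) ?card_bool//.
  apply: eq_wavg => d _; rewrite -(wavg_map _ _ (injf d)).
  by apply: eq_wavg => s _; rewrite flip add0r.
rewrite -wavgZ; apply: wavg_le => d _.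
have j0 : 'I_N by exact: Ordinal N_gt0.
set rho := wavg n (fun s => `|signed_count j0 s|).
apply: (@le_trans _ _ (rho * `|signed_sum x d|)).
  by rewrite ler_wpM2r// abs_signed_count_ge.
have -> : rho * `|signed_sum x d| = `|\sum_j
    wavg n (fun s => `|signed_count j s|) *: ((-1) ^+ nth false d j *: x j)|.
  have r0 : 0 <= rho by apply: wavg_ge0.
  rewrite -{1}(ger0_norm r0) -normrZ scaler_sumr; congr `|_|.
  by apply: eq_bigr => j _; rewrite -(abs_signed_count_eq _ j0).
apply: le_trans (norm_sum_wavg_le _ _ _) _; apply: wavg_le => s _.
apply/eqW; congr `|_|.
by apply: eq_bigr => j _; rewrite !scalerA mulrC.
Qed.

End Letters.

End SignedLetters.

(** * From exit tails to the Rademacher inequality *)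

Section RademacherFromTails.
Context {R : realType} {V : normedModType R}.

Lemma wavg_signed_sum_eq0 N (x : 'I_N -> V) : \sum_i `|x i| ^+ 2 = 0 :> R ->
  wavg N (fun d => `|signed_sum x d| ^+ 2) = 0.
Proof.
move=> qE; have x0 i : x i = 0.
  have /psumr_eq0P : forall i, true -> 0 <= `|x i| ^+ 2 :> R.
    by move=> j _; exact: sqr_ge0.
  move=> /(_ qE i isT)/eqP; rewrite expf_eq0/= normr_eq0.
  by move/eqP.
transitivity (wavg N (fun _ : seq bool => 0 : R)); last first.
  by rewrite wavg_cst ?card_bool.
apply: eq_wavg => d _; rewrite /signed_sum big1 ?normr0 ?expr0n// => i _.
by rewrite x0 scaler0.
Qed.

(** The lower bound sqrt (n / N) / 4 * L and the upper bound 3 * sqrt D both scale as sqrt n, so the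
    threshold r0 leaves no trace. Squaring gives L^2 <= 16 * 9 * 8 / c * q = 1152 / c * q, and
    Kahane's inequality doubles this to 2304. *)
Lemma rademacher_of_exit_tails N (x : 'I_N -> V) (c r0 : R) :
  (0 < N)%N -> 0 < c -> 0 < \sum_i `|x i| ^+ 2 ->
  (forall u n, r0 <= u -> (1 <= n)%N ->
    wavg n (fun s => (~~ stay (letter x) u 0 s)%:R)
    <= 8 * n%:R * (N%:R^-1 * \sum_i `|x i| ^+ 2) / (c * u ^+ 2)) ->
  wavg N (fun d => `|signed_sum x d| ^+ 2) <= 2304 / c * \sum_i `|x i| ^+ 2.
Proof.
move=> N0 c0 q0 tails; set q := \sum_i _ in q0 *.
have NR0 : 0 < N%:R :> R by rewrite ltr0n.
(* At least N for the lower bound on the coefficients, and large enough that the cut-off a lies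
   beyond r0. *)
pose n := maxn N (Num.truncn (r0 ^+ 2 * c * N%:R / (8 * q))).+1.
have Nn : (N <= n)%N by rewrite leq_maxl.
have n1 : (1 <= n)%N by rewrite (leq_trans N0).
have nR0 : 0 < n%:R :> R by rewrite ltr0n.
pose D : R := 8 * n%:R * (N%:R^-1 * q) / c.
have D0 : 0 < D by rewrite !mulr_gt0// ?invr_gt0.
(* This cut-off makes the two terms of the layer bound comparable: a + 2 D / a = 3 a. *)
pose a := Num.sqrt D.
have a0 : 0 < a by rewrite sqrtr_gt0.
have a2 : a ^+ 2 = D by rewrite sqr_sqrtr// ltW.
have r0a : r0 <= a.
  have [r00|r00] := ltP r0 0; first by rewrite ltW// (lt_trans r00).
  rewrite -(@ler_pXn2r _ 2%N)// ?nnegrE// ?(ltW a0)// a2 /D.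
  have : r0 ^+ 2 * c * N%:R / (8 * q) <= n%:R.
    by apply/ltW; apply: (lt_le_trans (truncnS_gt _)); rewrite ler_nat leq_maxr.
  rewrite ler_pdivrMr ?mulr_gt0// => H.
  rewrite ler_pdivlMr// -(ler_pM2r NR0) (le_trans H)//.
  by apply/eqW; field; rewrite gt_eqF.
pose S (s : seq ('I_N * bool)) := \sum_(b <- s) letter x b.
have Sbound s : size s = n -> `|S s| <= n%:R * \sum_b `|letter x b|.
  move=> <-; rewrite /S; elim: s => [|b s IHs].
    by rewrite big_nil normr0 mul0r.
  rewrite big_cons (le_trans (ler_normD _ _))// -nat1r mulrDl mul1r lerD//.
  by rewrite (bigD1 b)//= lerDl sumr_ge0.
have up : wavg n (fun s => `|S s|) <= 3 * a.
  have -> : 3 * a = a + 2 * D / a by rewrite -a2; field; rewrite gt_eqF.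
  apply: (wavg_layer_cake (letters_gt0 N0) a0 Sbound) => u au.
  apply: (@le_trans _ _ (8 * n%:R * (N%:R^-1 * q) / (c * u ^+ 2))); last first.
    by rewrite /D invfM !mulrA.
  apply: le_trans (tails _ _ (le_trans r0a au) n1).
  apply: wavg_le => s _; rewrite ler_nat.
  case: ltP => //= uS; rewrite lt0b.
  by apply/negP => /(stay_norm (le_trans (ltW a0) au)); rewrite leNgt uS.
have low := signed_sum_le_word x N0 Nn.
set L := wavg N _ in low.
have L0 : 0 <= L by apply: wavg_ge0 => s.
have {low up} LS : Num.sqrt (n%:R / N%:R) / 4 * L <= 3 * a := le_trans low up.
apply: (le_trans (khintchine_kahane x)); rewrite -/L.
have L2 : (Num.sqrt (n%:R / N%:R) / 4 * L) ^+ 2 <= (3 * a) ^+ 2.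
  by rewrite ler_pXn2r// nnegrE ?mulr_ge0// ?sqrtr_ge0// ltW.
have {}L2 : n%:R / N%:R * L ^+ 2 <= n%:R / N%:R * (1152 / c * q).
  move: L2; rewrite !exprMn a2 sqr_sqrtr; last by rewrite divr_ge0.
  rewrite /D => H; suff : n%:R / N%:R * (1152 / c * q) =
     16 * (3 ^+ 2 * (8 * n%:R * (N%:R^-1 * q) / c)) by move: H; lra.
  by field; rewrite !gt_eqF.
rewrite ler_pM2l ?divr_gt0// in L2.
have -> : 2304 / c * q = 2 * (1152 / c * q) by field; rewrite gt_eqF.
by rewrite ler_pM2l.
Qed.

End RademacherFromTails.

(** * Finite product measures *)

Lemma sqr_norm_convex (R : realType) (V : normedModType R) (I : finType)
    (w : I -> R) (z : I -> V) :
  (forall i, 0 <= w i) -> \sum_i w i = 1 ->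
  `|\sum_i w i *: z i| ^+ 2 <= \sum_i w i * `|z i| ^+ 2.
Proof.
move=> w0 w1; set m := \sum_i w i * `|z i|.
have m_ge : `|\sum_i w i *: z i| <= m.
  rewrite (le_trans (ler_norm_sum _ _ _))// ler_sum// => i _.
  by rewrite normrZ ger0_norm.
apply: (@le_trans _ _ (m ^+ 2)).
  by rewrite ler_pXn2r// nnegrE// (le_trans _ m_ge).
have : 0 <= \sum_i w i * (`|z i| - m) ^+ 2.
  by apply: sumr_ge0 => i _; rewrite mulr_ge0// sqr_ge0.
suff -> : \sum_i w i * (`|z i| - m) ^+ 2 =
  \sum_i w i * `|z i| ^+ 2 - 2 * m * m + (\sum_i w i) * m ^+ 2.
  by rewrite w1; lra.
have -> : 2 * m * m = \sum_i 2 * m * (w i * `|z i|) by rewrite -mulr_sumr.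
rewrite mulr_suml -sumrB -big_split/=.
by apply: eq_bigr => i _; ring.
Qed.

Lemma sqr_normB_le (R : realType) (V : normedModType R) (x y : V) :
  `|x - y| ^+ 2 <= 2 * (`|x| ^+ 2 + `|y| ^+ 2).
Proof.
have := ler_normB x y; have := normr_ge0 (x - y).
move: `|x - y| `|x| `|y| => d a b d0 dab.
have d2 : d ^+ 2 <= (a + b) ^+ 2 by rewrite ler_pXn2r// nnegrE (le_trans d0).
by rewrite (le_trans d2)// -subr_ge0 (_ : _ - _ = (a - b) ^+ 2) ?sqr_ge0//; ring.
Qed.

Section FiniteProduct.
Context {R : realType} {V : normedModType R} {F : finType} (n : nat).
Variable p : 'I_n -> F -> R.
Hypotheses (p_ge0 : forall i a, 0 <= p i a) (p_sum1 : forall i, \sum_a p i a = 1).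
Implicit Types v w : {ffun 'I_n -> F}.

Definition prodw v : R := \prod_i p i (v i).

Lemma prodw_ge0 v : 0 <= prodw v.
Proof. by apply: prodr_ge0. Qed.

Lemma sum_prodw : \sum_v prodw v = 1.
Proof.
rewrite -(bigA_distr_bigA (fun i a => p i a))/=.
by apply: big1 => i _.
Qed.

(** The condition on coordinate i is written as a product over all coordinates, so that the sum of
    products becomes a product of sums. *)
Lemma sum_prodw_marginal i a : \sum_(v : {ffun 'I_n -> F} | v i == a) prodw v = p i a.
Proof.
rewrite big_mkcond/=.
transitivity (\sum_(v : {ffun 'I_n -> F})
    \prod_k (p k (v k) * ((k == i) ==> (v k == a))%:R)).
  apply: eq_bigr => v _; rewrite big_split/= -/(prodw v).
  rewrite (bigD1 i)//= eqxx /= big1 ?mulr1; last first.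
    by move=> k /negbTE ->.
  by case: eqP; rewrite ?mulr1 ?mulr0.
rewrite -(bigA_distr_bigA (fun k b => p k b * ((k == i) ==> (b == a))%:R))/=.
rewrite (bigD1 i)//= [X in _ * X]big1 ?mulr1; last first.
  move=> k /negbTE ki; rewrite -[RHS](p_sum1 k).
  by apply: eq_bigr => b _; rewrite ki mulr1.
rewrite (bigD1 a)//= !eqxx mulr1 big1 ?addr0// => b /negbTE ->.
by rewrite mulr0.
Qed.

Lemma sum_prodw_coordZ (W : lmodType R) i (z : F -> W) :
  \sum_(v : {ffun 'I_n -> F}) prodw v *: z (v i) = \sum_a p i a *: z a.
Proof.
rewrite (partition_big (fun v : {ffun 'I_n -> F} => v i) xpredT)//=.
apply: eq_bigr => a _; rewrite -sum_prodw_marginal scaler_suml.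
by apply: eq_bigr => v /eqP ->.
Qed.

Lemma sum_prodw_coord i (f : F -> R) :
  \sum_(v : {ffun 'I_n -> F}) prodw v * f (v i) = \sum_a p i a * f a.
Proof. exact: (@sum_prodw_coordZ R^o). Qed.

Definition swapv (A : pred 'I_n) v w : {ffun 'I_n -> F} :=
  [ffun i => if A i then w i else v i].

(** Two independent copies may exchange any set of coordinates without changing their joint weight.
    This one fact serves both symmetrization and Ottaviani's inequality. *)
Lemma sum_prodw_swap (A : pred 'I_n)
    (G : {ffun 'I_n -> F} -> {ffun 'I_n -> F} -> R) :
  \sum_v \sum_w prodw v * prodw w * G v w =
  \sum_v \sum_w prodw v * prodw w * G (swapv A v w) (swapv A w v).
Proof.
rewrite !pair_big/=.
pose h (u : {ffun 'I_n -> F} * {ffun 'I_n -> F}) :=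
  (swapv A u.1 u.2, swapv A u.2 u.1).
have hK : involutive h.
  move=> [v w]; rewrite /h/=; congr pair; apply/ffunP => i; rewrite !ffunE.
    by case: (A i).
  by case: (A i).
rewrite (reindex_inj (inv_inj hK))/=; apply: eq_bigr => -[v w] _ /=.
congr (_ * _); rewrite /prodw -!big_split/=; apply: eq_bigr => i _.
by rewrite !ffunE; case: (A i); rewrite // mulrC.
Qed.

(* Symmetrization: exchanging the coordinates i with nth false s i between the
   independent copies v and w changes the sign of those differences. *)
Lemma sum_prodw_symm (y : 'I_n -> F -> V) (K : R) : 0 <= K ->
  (forall x : 'I_n -> V, wavg n (fun s => `|signed_sum x s| ^+ 2)
     <= K * \sum_i `|x i| ^+ 2) ->
  \sum_v prodw v * `|\sum_i (y i (v i) - \sum_a p i a *: y i a)| ^+ 2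
  <= 4 * K * \sum_i \sum_a p i a * `|y i a| ^+ 2.
Proof.
move=> K0 rad.
pose D v w i := y i (v i) - y i (w i).
(* Centring is averaging over an independent copy w; Jensen's inequality then moves the average
   outside the square. *)
have meanE v : \sum_i (y i (v i) - \sum_a p i a *: y i a) =
    \sum_w prodw w *: \sum_i D v w i.
  under [in RHS]eq_bigr do rewrite scaler_sumr.
  rewrite exchange_big/=; apply: eq_bigr => i _.
  under [RHS]eq_bigr do rewrite scalerBr.
  rewrite sumrB -scaler_suml sum_prodw scale1r.
  by rewrite (sum_prodw_coordZ i).
apply: (@le_trans _ _
    (\sum_v \sum_w prodw v * prodw w * `|\sum_i D v w i| ^+ 2)).
  apply: ler_sum => v _; under [leRHS]eq_bigr do rewrite -mulrA.
  rewrite -mulr_sumr ler_wpM2l ?prodw_ge0// meanE.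
  by apply: sqr_norm_convex; [exact: prodw_ge0|exact: sum_prodw].
have signE s : \sum_v \sum_w prodw v * prodw w * `|\sum_i D v w i| ^+ 2 =
    \sum_v \sum_w prodw v * prodw w * `|signed_sum (D v w) s| ^+ 2.
  rewrite (sum_prodw_swap (fun i => nth false s i)
    (fun v w => `|\sum_i D v w i| ^+ 2)).
  apply: eq_bigr => v _; apply: eq_bigr => w _; congr (_ * `|_| ^+ 2).
  apply: eq_bigr => i _; rewrite /D !ffunE.
  by case: (nth false s i); rewrite ?expr0 ?scale1r ?expr1 ?scaleN1r ?opprB.
have -> : \sum_v \sum_w prodw v * prodw w * `|\sum_i D v w i| ^+ 2 =
    \sum_v \sum_w prodw v * prodw w *
      wavg n (fun s => `|signed_sum (D v w) s| ^+ 2).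
  rewrite -[LHS](@wavg_cst _ bool _ n) ?card_bool//.
  transitivity (wavg n (fun s =>
      \sum_v \sum_w prodw v * prodw w * `|signed_sum (D v w) s| ^+ 2)).
    by apply: eq_wavg => s _; exact: signE.
  rewrite wavg_sum; apply: eq_bigr => v _; rewrite wavg_sum.
  by apply: eq_bigr => w _; rewrite wavgZ.
(* Each squared difference is at most twice the sum of two squares, and the two copies have equal
   means: hence 2 * 2 * K. *)
have -> : 4 * K * \sum_i \sum_a p i a * `|y i a| ^+ 2 =
    \sum_v \sum_w prodw v * prodw w *
      (2 * K * \sum_i (`|y i (v i)| ^+ 2 + `|y i (w i)| ^+ 2)).
  pose Q v := \sum_i `|y i (v i)| ^+ 2.
  have QE : \sum_v prodw v * Q v = \sum_i \sum_a p i a * `|y i a| ^+ 2.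
    under eq_bigr do rewrite mulr_sumr.
    rewrite exchange_big/=; apply: eq_bigr => i _.
    exact: (sum_prodw_coord i (fun a => `|y i a| ^+ 2)).
  transitivity (\sum_v (2 * K * (prodw v * Q v)
      + 2 * K * (prodw v * \sum_w prodw w * Q w))).
    rewrite big_split/= -!mulr_sumr -mulr_suml sum_prodw mul1r QE.
    by rewrite -mulrDl; congr (_ * _); ring.
  apply: eq_bigr => v _.
  transitivity (\sum_w (prodw w * (2 * K * (prodw v * Q v))
      + 2 * K * (prodw v * (prodw w * Q w)))).
    by rewrite big_split/= -mulr_suml sum_prodw mul1r -!mulr_sumr.
  by apply: eq_bigr => w _; rewrite big_split/= -/(Q v) -/(Q w); ring.
apply: ler_sum => v _; apply: ler_sum => w _.
rewrite ler_wpM2l ?mulr_ge0 ?prodw_ge0// (le_trans (rad _))//.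
rewrite -mulrA mulrCA ler_wpM2l// mulr_sumr ler_sum// => i _.
exact: sqr_normB_le.
Qed.

Section Ottaviani.
Variable z : 'I_n -> F -> V.

Definition partial_sum v (k : nat) : V := \sum_(i < n | (i < k)%N) z i (v i).
Definition tail_sum v (k : nat) : V := \sum_(i < n | (k <= i)%N) z i (v i).

Lemma partial_sum_tail v k :
  partial_sum v n = partial_sum v k + tail_sum v k.
Proof.
rewrite /partial_sum /tail_sum.
rewrite [LHS](_ : _ = \sum_(i < n) z i (v i)).
  rewrite (bigID (fun i : 'I_n => (i < k)%N))/=; congr (_ + _).
  by apply: eq_bigl => i; rewrite -leqNgt.
by apply: eq_bigl => i; rewrite ltn_ord.
Qed.

(* The first-passage event E k depends on the coordinates i < k only; swapping
   the coordinates k <= i between two copies decouples it from the tail sum. *)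
Lemma ottaviani (t : R) :
  (forall k, \sum_v prodw v * (t < `|tail_sum v k|)%R%:R <= 2^-1) ->
  \sum_v prodw v * [exists k : 'I_n.+1, 2 * t < `|partial_sum v k|]%:R
  <= 2 * \sum_v prodw v * (t < `|partial_sum v n|)%R%:R.
Proof.
move=> tails.
pose E (k : 'I_n.+1) v := (2 * t < `|partial_sum v k|) &&
  [forall j : 'I_n.+1, (j < k)%N ==> (`|partial_sum v j| <= 2 * t)].
have E1 v : \sum_k (E k v)%:R =
    [exists k : 'I_n.+1, 2 * t < `|partial_sum v k|]%:R :> R.
  case: existsP => [[k0 k0E]|nE]; last first.
    rewrite big1// => k _; case: (boolP (E k v)) => // /andP[kE _].
    by exfalso; apply: nE; exists k.
  have [k kE kmin] := @arg_minnP _ k0 (fun k => 2 * t < `|partial_sum v k|)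
    (fun k : 'I_n.+1 => k : nat) k0E.
  rewrite (bigD1 k)//= big1 ?addr0 => [|j jk].
    rewrite /E kE /= (_ : [forall _, _])//; apply/forallP => j.
    apply/implyP => jk; rewrite leNgt; apply/negP => /kmin.
    by rewrite leqNgt jk.
  case: (boolP (E j v)) => // /andP[jE /forallP/(_ k)].
  rewrite leNgt kE implybF -leqNgt => jk'.
  by case/eqP: jk; apply/val_inj/eqP; rewrite eqn_leq jk' kmin.
have key k : \sum_v prodw v * (E k v)%:R <=
    2 * \sum_v prodw v * (E k v && (t < `|partial_sum v n|))%:R.
  rewrite -ler_pdivrMl//.
  pose H v := (`|tail_sum v k| <= t).
  have HE : 2^-1 <= \sum_v prodw v * (H v)%:R.
    have <- : 1 - \sum_v prodw v * (t < `|tail_sum v k|)%R%:R =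
        \sum_v prodw v * (H v)%:R.
      rewrite -{1}sum_prodw -sumrB; apply: eq_bigr => v _.
      by rewrite /H; case: leP; rewrite ?mulr1 ?mulr0 ?subr0 ?subrr.
    by have := tails k; lra.
  apply: (@le_trans _ _ (\sum_v \sum_w prodw v * prodw w * ((E k v)%:R * (H w)%:R))).
    rewrite mulr_sumr ler_sum// => v _.
    apply: (@le_trans _ _ (prodw v * (E k v)%:R * \sum_w prodw w * (H w)%:R)).
      by rewrite mulrC ler_wpM2l// mulr_ge0// prodw_ge0.
    rewrite mulr_sumr le_eqVlt; apply/orP; left; apply/eqP.
    by apply: eq_bigr => w _; ring.
  rewrite (sum_prodw_swap (fun i => k <= i)%N (fun v w => (E k v)%:R * (H w)%:R)).
  apply: ler_sum => v _.
  have psw w j : (j <= k)%N -> partial_sum (swapv (fun i => k <= i)%N v w) j =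
      partial_sum v j.
    move=> jk; apply: eq_bigr => i ij; rewrite ffunE.
    by rewrite leqNgt (leq_trans ij jk).
  have Esw w : E k (swapv (fun i => k <= i)%N v w) = E k v.
    rewrite /E psw//; congr (_ && _); apply: eq_forallb => j.
    by case: (ltnP j k) => //= jk; rewrite psw// ltnW.
  have Hsw w : H (swapv (fun i => k <= i)%N w v) = H v.
    rewrite /H; congr (`|_| <= _); apply: eq_bigr => i ki.
    by rewrite ffunE ki.
  under eq_bigr do rewrite Esw Hsw mulrAC.
  rewrite -mulr_sumr sum_prodw mulr1 ler_wpM2l ?prodw_ge0//.
  rewrite -natrM ler_nat; case: (boolP (E k v)) => //= /andP[kE _].
  case: (boolP (H v)) => //= Hv; rewrite lt0b.
  (* A sum beyond 2 t at time k, followed by a tail of norm at most t, ends beyond t. *)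
  rewrite (partial_sum_tail v k).
  have := ler_normB (partial_sum v k + tail_sum v k) (tail_sum v k).
  by rewrite addrK; move: kE Hv; rewrite /H; lra.
apply: (@le_trans _ _ (\sum_(k < n.+1) \sum_v prodw v * (E k v)%:R)).
  rewrite exchange_big/= ler_sum// => v _.
  by rewrite -mulr_sumr E1.
apply: (le_trans (ler_sum _ (fun k _ => key k))).
rewrite -mulr_sumr ler_pM2l// exchange_big/= ler_sum// => v _.
rewrite -mulr_sumr ler_wpM2l ?prodw_ge0//.
under eq_bigr do rewrite -mulnb natrM.
by rewrite -mulr_suml E1 ler_piMl// lern1 leq_b1.
Qed.

End Ottaviani.
End FiniteProduct.

(** * Finite-valued random elements *)

Lemma open_borel (B : topologicalType) (A : set B) : open A -> borel A.
Proof. by move=> oA; exact: sub_gen_smallest. Qed.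

Lemma closed_borel (B : ptopologicalType) (A : set B) : closed A -> borel A.
Proof.
move=> cA; rewrite -[A]setCK.
apply: (@measurableC _ (g_sigma_algebraType (@open B))).
by change (borel (~` A)); apply: open_borel; exact: closed_openC.
Qed.

Lemma borel_norm_gt (R : realType) (B : normedModType R) (r : R) :
  borel [set b : B | r < `|b|].
Proof.
apply: open_borel.
rewrite (_ : [set _ | _] = (fun b : B => `|b|) @^-1` [set x | r < x])//.
by apply: open_comp; [move=> b _; exact: norm_continuous|exact: open_gt].
Qed.

Lemma measurable_set_gt d (T : measurableType d) (R : realType) (f : T -> R) a :
  measurable_fun setT f -> measurable [set w | a < f w].
Proof.
have mI : measurable (`]a, +oo[ : set R) by exact: measurable_itv.
move=> /(_ measurableT _ mI); rewrite setTI; congr (measurable _).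
by apply/seteqP; split=> w; rewrite /= in_itv/= andbT.
Qed.

Lemma measurable_set_ge d (T : measurableType d) (R : realType) (f : T -> R) a :
  measurable_fun setT f -> measurable [set w | a <= f w].
Proof.
have mI : measurable (`[a, +oo[ : set R) by exact: measurable_itv.
move=> /(_ measurableT _ mI); rewrite setTI; congr (measurable _).
by apply/seteqP; split=> w; rewrite /= in_itv/= andbT.
Qed.

Lemma expectationE d (T : measurableType d) (R : realType)
    (P : probability T R) (X : T -> R) : 'E_P[X]%E = (\int[P]_w (X w)%:E)%E.
Proof. by rewrite unlock. Qed.

Section FiniteValued.
Context {R : realType} {B : completeNormedModType R}.
Context d (T : measurableType d) (P : probability T R).

Definition measurable_fibers (F : finType) (Q : T -> F) :=
  forall a, measurable (Q @^-1` [set a]).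

Definition mass (F : finType) (Q : T -> F) (a : F) : R :=
  fine (P (Q @^-1` [set a])).

Section OneVariable.
Context (F : finType) (Q : T -> F) (mQ : measurable_fibers Q).

Lemma measurable_fiber_preimage (A : set F) : measurable (Q @^-1` A).
Proof.
rewrite (_ : Q @^-1` A = \bigcup_(a in A) (Q @^-1` [set a])).
  by apply: fin_bigcup_measurable => // *; exact: finite_finset.
by apply/seteqP; split=> [w Aw|w [a Aa /= ->]]//; exists (Q w).
Qed.

Lemma measurable_fun_fibers d' (U : measurableType d') (g : F -> U) :
  measurable_fun setT (fun w => g (Q w)).
Proof.
by move=> _ Y mY; rewrite setTI; exact: (measurable_fiber_preimage (g @^-1` Y)).
Qed.

Lemma massE a : P (Q @^-1` [set a]) = (mass Q a)%:E.
Proof. by rewrite fineK// fin_num_measure. Qed.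

Lemma mass_ge0 a : 0 <= mass Q a.
Proof. exact: fine_ge0. Qed.

Lemma expectation_fibers (g : F -> R) : (forall a, 0 <= g a) ->
  (\int[P]_w (g (Q w))%:E = (\sum_a mass Q a * g a)%:E)%E.
Proof.
move=> g0.
transitivity (\int[P]_w (\sum_a (g a)%:E * (\1_(Q @^-1` [set a]) w)%:E))%E.
  apply: eq_integral => w _; rewrite (bigD1 (Q w))//= big1 ?adde0.
    by rewrite indicE mem_set ?mule1.
  by move=> a aQ; rewrite indicE memNset ?mule0// => /= E; rewrite E eqxx in aQ.
rewrite ge0_integral_sum//=.
- rewrite -sumEFin; apply: eq_bigr => a _.
  rewrite ge0_integralZl//=.
  + rewrite integral_indic// setIT [RHS]EFinM [RHS]muleC.
    by congr (_ * _)%E; exact: massE.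
  + exact/measurable_EFinP/measurable_indic.
  + by rewrite lee_fin.
- move=> a; apply: measurable_funeM; exact/measurable_EFinP/measurable_indic.
- by move=> a w _; rewrite mule_ge0// lee_fin.
Qed.

Lemma prob_fibers (A : pred F) :
  P [set w | A (Q w)] = (\sum_a mass Q a * (A a)%:R)%:E.
Proof.
rewrite -expectation_fibers// -[LHS]/(P (Q @^-1` [set a | A a])).
rewrite -[X in P X]setIT -integral_indic//; last exact: measurable_fiber_preimage.
apply: eq_integral => w _; rewrite indicE.
by case: (boolP (A (Q w))) => AQ; [rewrite mem_set|rewrite memNset//; exact/negP].
Qed.

Lemma sum_mass : \sum_a mass Q a = 1.
Proof.
have := prob_fibers predT; rewrite [X in P X](_ : _ = setT); last first.
  by apply/seteqP; split.
rewrite probability_setT => -[->].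
by apply: eq_bigr => a _; rewrite mulr1.
Qed.

Lemma simple_element_fibers (y : F -> B) : simple_element (fun w => y (Q w)).
Proof.
split; first by move=> A _; exact: (measurable_fiber_preimage (y @^-1` A)).
apply: (@sub_finite_set _ _ (range y)).
  by move=> _ [w _ <-]; exists (Q w).
by apply: finite_image; exact: finite_finset.
Qed.

(** [simple_expectation] sums over values, the right side over labels. Labels with a common value
    are grouped, and a label whose value is never taken has an empty fibre, hence mass 0. *)
Lemma simple_expectation_fibers (y : F -> B) :
  simple_expectation P (fun w => y (Q w)) = \sum_a mass Q a *: y a.
Proof.
have [_ fin] := simple_element_fibers y.
rewrite /simple_expectation fsbig_finite//=.
set s : seq B := finmap.enum_fset _.
transitivity (\sum_(b <- s) \sum_(a | y a == b) mass Q a *: y a).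
  apply: eq_bigr => b _.
  rewrite [X in P X](_ : _ = [set w | y (Q w) == b]); last first.
    by apply/seteqP; split => w /= /eqP.
  rewrite (prob_fibers (fun a => y a == b)) /= scaler_suml [RHS]big_mkcond/=.
  apply: eq_bigr => a _.
  by case: eqP => [->|_]; rewrite ?mulr1// mulr0 scale0r.
rewrite (exchange_big_dep xpredT)//=; apply: eq_bigr => a _.
have [ys|ys] := boolP (y a \in s).
  have us : uniq s by exact: fset_uniq.
  rewrite big_mkcond (bigD1_seq (y a) ys us) /= eqxx big1 ?addr0//.
  by move=> b /negbTE; rewrite eq_sym => ->.
rewrite big1_seq/=; last first.
  by move=> b /andP[/eqP <-]; rewrite (negbTE ys).
rewrite /mass (_ : _ @^-1` _ = set0) ?measure0 ?scale0r//.
apply/seteqP; split => // w /= E; move/negP: ys; apply.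
by rewrite in_fset_set//; apply/mem_set; exists w => //; rewrite E.
Qed.

Lemma has_expectation_fibers (y : F -> B) :
  has_expectation P (fun w => y (Q w)) (\sum_a mass Q a *: y a).
Proof.
split; first by case: (simple_element_fibers y).
exists (fun _ w => y (Q w)); split.
- by move=> _; exact: simple_element_fibers.
- rewrite (_ : (fun _ => _) = cst 0%E); first exact: cvg_cst.
  apply/funext => k /=; rewrite expectationE; apply: integral0_eq => w _.
  by rewrite subrr normr0.
- rewrite (_ : (fun _ => _) = cst (\sum_a mass Q a *: y a)).
    exact: cvg_cst.
  by apply/funext => k; exact: simple_expectation_fibers.
Qed.

End OneVariable.

Lemma measurable_fibers_pair (F G : finType) (Q : T -> F) (Q' : T -> G) :
  measurable_fibers Q -> measurable_fibers Q' ->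
  measurable_fibers (fun w => (Q w, Q' w)).
Proof.
move=> mQ mQ' [a b].
rewrite (_ : _ @^-1` _ = Q @^-1` [set a] `&` Q' @^-1` [set b]).
  exact: measurableI.
by apply/seteqP; split=> w /= [-> ->].
Qed.

Lemma simple_element_factor (s : T -> B) : simple_element s ->
  exists (F : finType) (Q : T -> F) (y : F -> B),
    measurable_fibers Q /\ s = fun w => y (Q w).
Proof.
move=> [ms fin].
have sP w : s w \in fset_set (range s) by rewrite in_fset_set//; apply/mem_set; exists w.
exists (fset_set (range s)), (fun w => [` sP w]%fset), (fun a => fsval a).
split=> // a.
rewrite (_ : _ @^-1` _ = s @^-1` [set fsval a]).
  by apply: ms; apply: closed_borel; apply: accessible_closed_set1;
    apply: hausdorff_accessible; exact: norm_hausdorff.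
by apply/seteqP; split=> w /= => [<-//|E]; exact: val_inj.
Qed.

(** Both elements are functions of the pair of their labels; on this common refinement the triangle
    inequality applies term by term. *)
Lemma simple_expectation_dist (s1 s2 : T -> B) :
  simple_element s1 -> simple_element s2 ->
  ((`|simple_expectation P s1 - simple_expectation P s2|)%:E <=
   'E_P[(fun w => `|s1 w - s2 w|)%R])%E.
Proof.
move=> /simple_element_factor[F [Q1 [y1 [mQ1 ->]]]].
move=> /simple_element_factor[G [Q2 [y2 [mQ2 ->]]]].
pose Q w := (Q1 w, Q2 w); have mQ := measurable_fibers_pair mQ1 mQ2.
rewrite (simple_expectation_fibers mQ (fun a => y1 a.1)).
rewrite (simple_expectation_fibers mQ (fun a => y2 a.2)) expectationE.
have /= -> := expectation_fibers mQ (fun a => normr_ge0 (y1 a.1 - y2 a.2)).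
rewrite lee_fin.
rewrite -sumrB (le_trans (ler_norm_sum _ _ _))// ler_sum// => a _.
by rewrite -scalerBr normrZ ger0_norm// mass_ge0.
Qed.

End FiniteValued.

(** * Quantization *)

Section Quantizer.
Context {R : realType} {B : completeNormedModType R}.
Variable e : nat -> B.

Fixpoint nearest m (b : B) : nat :=
  if m is m'.+1 then
    if `|b - e m| < `|b - e (nearest m' b)| then m else nearest m' b
  else 0%N.

Lemma nearest_le m b : (nearest m b <= m)%N.
Proof. by elim: m => //= m IHm; case: ifP => // _; rewrite ltnW. Qed.

Lemma nearest_min m b j : (j <= m)%N ->
  `|b - e (nearest m b)| <= `|b - e j|.
Proof.
elim: m => [|m IHm] /=; first by rewrite leqn0 => /eqP ->.
rewrite leq_eqVlt => /predU1P[->|]; first by case: ltP => // /ltW.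
rewrite ltnS => /IHm; case: ltP => // + jm; move/ltW/le_trans; exact.
Qed.

Lemma borel_closer i j : borel [set b | `|b - e i| < `|b - e j|].
Proof.
apply: open_borel.
rewrite (_ : [set _ | _] = (fun b => `|b - e j| - `|b - e i|) @^-1` [set x | 0 < x]).
  apply: open_comp; last exact: open_gt.
  move=> b _; apply: cvgB; apply: cvg_norm; apply: cvgB => //; exact: cvg_cst.
by apply/seteqP; split=> b /=; rewrite subr_gt0.
Qed.

Lemma borel_nearest m j : borel [set b | nearest m b = j].
Proof.
pose BT := g_sigma_algebraType (@open B).
have mC i k : @measurable _ BT [set b | `|b - e i| < `|b - e k|].
  exact: borel_closer.
suff : @measurable _ BT [set b | nearest m b = j] by [].
elim: m j => [|m IHm] j.
  case: j => [|j].
    rewrite (_ : [set _ | _] = setT); first exact: measurableT.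
    by apply/seteqP; split.
  rewrite (_ : [set _ | _] = set0); first exact: measurable0.
  by apply/seteqP; split.
(* The set where the new point wins, cut along the values of the old index so that only comparisons
   with a fixed point occur. *)
pose C := \bigcup_i ([set b | nearest m b = i] `&`
                     [set b | `|b - e m.+1| < `|b - e i|]) : set BT.
have mC' : measurable C.
  by apply: bigcupT_measurable => i; apply: measurableI; [exact: IHm|exact: mC].
have CE b : C b = (`|b - e m.+1| < `|b - e (nearest m b)|).
  apply/propext; split; first by move=> [i _ [/= -> ]].
  by move=> h; exists (nearest m b).
have [->|jm] := eqVneq j m.+1.
  rewrite (_ : [set _ | _] = C)//; apply/seteqP; split=> b /=.
    rewrite CE; case: ifP => // _ nE.
    by have := nearest_le m b; rewrite nE ltnn.
  by rewrite CE => ->.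
rewrite (_ : [set _ | _] = [set b | nearest m b = j] `\` C).
  by apply: measurableD => //; exact: IHm.
apply/seteqP; split=> b /=; rewrite CE.
  by case: ifP => // _ E; rewrite E eqxx in jm.
by move=> [<- /negP/negbTE ->].
Qed.

Definition quant_index m (b : B) : 'I_m.+1 := inord (nearest m b).

Definition quant m (b : B) : B := e (quant_index m b).

Lemma quantE m b : quant m b = e (nearest m b).
Proof. by rewrite /quant inordK// ltnS nearest_le. Qed.

Lemma borel_quant_index m (A : set 'I_m.+1) : borel (quant_index m @^-1` A).
Proof.
pose BT := g_sigma_algebraType (@open B).
suff : @measurable _ BT (quant_index m @^-1` A) by [].
rewrite (_ : quant_index m @^-1` A = \bigcup_(i in A) [set b | nearest m b = i]).
  apply: fin_bigcup_measurable; first exact: finite_finset.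
  by move=> i _; exact: borel_nearest.
apply/seteqP; split=> [b Ab|b [i Ai /= bi]].
  exists (quant_index m b) => //=; first by rewrite inordK// ltnS nearest_le.
rewrite /quant_index bi (_ : inord i = i)//.
by apply: val_inj; rewrite /= inordK.
Qed.

Hypotheses (e0 : e 0%N = 0)
  (e_dense : forall b eps, 0 < eps -> exists j, `|b - e j| < eps).

(** Since 0 is always a candidate, the error is dominated by the norm itself. This feeds dominated
    convergence and yields |quant| <= 2 |b|, the source of the factor 4 in all second moments of
    quantized variables. *)
Lemma dist_quant_le m b : `|b - quant m b| <= `|b|.
Proof. by have := nearest_min b (leq0n m); rewrite quantE e0 subr0. Qed.

Lemma norm_quant_le m b : `|quant m b| <= 2 * `|b|.
Proof.
rewrite -[quant m b](subKr b) (le_trans (ler_normB _ _))//.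
by rewrite mulr_natl mulr2n lerD2l dist_quant_le.
Qed.

Lemma dist_quant_cvg b : `|b - quant m b| @[m --> \oo] --> (0 : R).
Proof.
apply/cvgrPdist_lt => eps eps0; have [j bj] := e_dense b eps0.
exists j => // m /= jm; rewrite sub0r normrN normr_id quantE.
exact: le_lt_trans (nearest_min _ jm) bj.
Qed.

Lemma quant_cvg b : quant m b @[m --> \oo] --> b.
Proof.
apply/cvgrPdist_lt => eps eps0.
by have /cvgrPdist_lt/(_ _ eps0) := @dist_quant_cvg b; under eq_near do
  rewrite sub0r normrN normr_id.
Qed.

End Quantizer.

Lemma separable_dense_seq (R : realType) (B : completeNormedModType R) :
  separable_space B -> exists e : nat -> B, e 0%N = 0 /\
    forall b eps, 0 < eps -> exists j, `|b - e j| < eps.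
Proof.
move=> [D /countable_injP[f finj] dD].
(* Index 0 is reserved for the vector 0; an index that codes no point of D also yields 0. *)
pose e (k : nat) : B := if k is k'.+1 then
  xget 0 [set x | D x /\ f x = k'] else 0.
exists e; split=> // b eps eps0.
have [|x [/= bx Dx]] := dD (ball b eps) _ (ball_open b eps).
  by exists b; exact: ballxx.
exists (f x).+1; rewrite /e (_ : xget _ _ = x); first by rewrite -ball_normE in bx.
apply: xget_unique => // y [Dy fy].
by apply: finj => //; exact/mem_set.
Qed.

(** * Measurability, quantization and Bochner expectations *)

Section Approximation.
Context {R : realType} {B : completeNormedModType R}.
Variable e : nat -> B.
Hypotheses (e0 : e 0%N = 0)
  (e_dense : forall b eps, 0 < eps -> exists j, `|b - e j| < eps).
Context d (T : measurableType d).
Implicit Types X Y : T -> B.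

Lemma measurable_fibers_quant m X : random_element X ->
  measurable_fibers (fun w => quant_index e m (X w)).
Proof. by move=> mX a; exact: (mX _ (borel_quant_index e [set a])). Qed.

Lemma measurable_fibers_ffun n (F : finType) (Q : 'I_n -> T -> F) :
  (forall i, measurable_fibers (Q i)) ->
  measurable_fibers (fun w => [ffun i => Q i w]).
Proof.
move=> mQ v.
rewrite (_ : _ @^-1` _ = \bigcap_(i in [set: 'I_n]) (Q i @^-1` [set v i])).
  apply: fin_bigcap_measurable; first exact: finite_finset.
  by move=> i _; exact: mQ.
apply/seteqP; split=> [w /= <- i _ /=|w Qw /=]; first by rewrite ffunE.
by apply/ffunP => i; rewrite ffunE; exact: Qw.
Qed.

(* Separability makes g a pointwise limit of finite-valued functions. *)
Lemma measurable_fun_seq_cont n (X : 'I_n -> T -> B) (g : ('I_n -> B) -> R) :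
  (forall i, random_element (X i)) ->
  (forall (u : nat -> 'I_n -> B) x, (forall i, u k i @[k --> \oo] --> x i) ->
    g (u k) @[k --> \oo] --> g x) ->
  measurable_fun setT (fun w => g (fun i => X i w)).
Proof.
move=> mX gc.
apply: (@measurable_fun_cvg _ _ _ _
  (fun m w => g (fun i => quant e m (X i w)))) => [m|w _].
  have mQ := measurable_fibers_ffun (fun i => @measurable_fibers_quant m _ (mX i)).
  have := measurable_fun_fibers mQ
    (fun v : {ffun 'I_n -> 'I_m.+1} => g (fun i => e (v i))).
  apply: eq_measurable_fun => w _; congr g; apply/funext => i.
  by rewrite ffunE.
by apply: gc => i; exact: quant_cvg.
Qed.

Lemma measurable_fun_norm X : random_element X ->
  measurable_fun setT (fun w => `|X w|).
Proof.
move=> mX; apply: (@measurable_fun_seq_cont 1 (fun=> X) (fun x => `|x ord0|)) => //.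
by move=> u x ux; apply: cvg_norm; exact: ux.
Qed.

Lemma measurable_fun_normB X Y : random_element X -> random_element Y ->
  measurable_fun setT (fun w => `|X w - Y w|).
Proof.
move=> mX mY.
apply: (@measurable_fun_seq_cont 2 (fun i => if i == ord0 then X else Y)
  (fun x => `|x ord0 - x ord_max|)).
  by move=> i; case: ifP.
by move=> u x ux; apply: cvg_norm; apply: cvgB; exact: ux.
Qed.

Lemma measurable_fun_norm_sum n (X : 'I_n -> T -> B) :
  (forall i, random_element (X i)) ->
  measurable_fun setT (fun w => `|\sum_i X i w|).
Proof.
move=> mX; apply: (@measurable_fun_seq_cont n X (fun x => `|\sum_i x i|)) => //.
move=> u x ux; apply: cvg_norm.
by apply: cvg_big => [|i _]; [exact: add_continuous|exact: ux].
Qed.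

Lemma random_element_comp X (f : B -> B) : random_element X ->
  (forall A, borel A -> borel (f @^-1` A)) -> random_element (fun w => f (X w)).
Proof. by move=> mX mf A /mf /mX. Qed.

Lemma random_element_quant m X : random_element X ->
  random_element (fun w => quant e m (X w)).
Proof.
by move=> mX A _; exact: (mX _ (borel_quant_index e (fun i : 'I_m.+1 => A (e i)))).
Qed.

Variable P : probability T R.

Lemma expectation_le (f g : T -> R) :
  measurable_fun setT f -> measurable_fun setT g ->
  (forall w, 0 <= f w <= g w) -> ('E_P[f] <= 'E_P[g])%E.
Proof.
move=> mf mg fg; rewrite !expectationE; apply: ge0_le_integral => //.
- by move=> w _; rewrite lee_fin; case/andP: (fg w).
- exact/measurable_EFinP.
- exact/measurable_EFinP.
- by move=> w _; rewrite lee_fin; case/andP: (fg w).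
Qed.

Lemma expectationD_ge0 (f g : T -> R) :
  measurable_fun setT f -> measurable_fun setT g ->
  (forall w, 0 <= f w) -> (forall w, 0 <= g w) ->
  ('E_P[(fun w => f w + g w)%R] = 'E_P[f] + 'E_P[g])%E.
Proof.
move=> mf mg f0 g0; rewrite !expectationE -ge0_integralD//.
- by move=> w _; rewrite lee_fin.
- exact/measurable_EFinP.
- by move=> w _; rewrite lee_fin.
- exact/measurable_EFinP.
Qed.

Lemma expectationZ_ge0 (k : R) (f : T -> R) : 0 <= k ->
  measurable_fun setT f -> (forall w, 0 <= f w) ->
  ('E_P[(fun w => k * f w)%R] = k%:E * 'E_P[f])%E.
Proof.
move=> k0 mf f0; rewrite !expectationE -ge0_integralZl//.
- exact/measurable_EFinP.
- by move=> w _; rewrite lee_fin.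
Qed.

Lemma expectation_dist_quant_cvg Y : random_element Y ->
  ('E_P[(fun w => `|Y w|)%R] < +oo)%E ->
  'E_P[(fun w => `|Y w - quant e m (Y w)|)%R]%E @[m --> \oo] --> 0%E.
Proof.
move=> mY Yoo.
have mN := measurable_fun_norm mY.
have mQ m := measurable_fun_normB mY (random_element_quant m mY).
have [] := @dominated_convergence _ T R P setT measurableT
  (fun m w => (`|Y w - quant e m (Y w)|)%:E) (cst 0%E) (fun w => `|Y w|%:E).
- by move=> m; exact/measurable_EFinP.
- exact: measurable_cst.
- apply: aeW => w _; apply/cvg_EFin.
    by near=> m.
  exact: dist_quant_cvg.
- apply/integrableP; split; first exact/measurable_EFinP.
  rewrite (eq_integral (fun w => `|Y w|%:E)); first by rewrite -expectationE.
  by move=> w _; rewrite /= normr_id.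
- by apply: aeW => w m _; rewrite /= lee_fin normr_id dist_quant_le.
move=> _ _; rewrite integral0_eq//.
by under eq_cvg do rewrite /= -expectationE.
Unshelve. all: by end_near. Qed.

Lemma expectation_dist_quant_lt Y (eps : R) : random_element Y ->
  ('E_P[(fun w => `|Y w|)%R] < +oo)%E -> 0 < eps ->
  \forall m \near \oo,
    ('E_P[(fun w => `|Y w - quant e m (Y w)|)%R] < eps%:E)%E.
Proof.
move=> mY Yoo eps0.
have /fine_cvgP[fin /cvgrPdist_lt/(_ _ eps0)] := expectation_dist_quant_cvg mY Yoo.
apply: filterS2 fin => m fin; rewrite sub0r normrN /= => small.
by rewrite -(fineK fin) lte_fin (le_lt_trans (ler_norm _)).
Qed.

(** The Bochner expectation is a contraction from L^1; this holds for the approximating simple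
    elements and passes to the limit. It shows that quantized means are close to the true mean. *)
Lemma has_expectation_dist Y1 Y2 m1 m2 :
  has_expectation P Y1 m1 -> has_expectation P Y2 m2 ->
  ((`|m1 - m2|)%:E <= 'E_P[(fun w => `|Y1 w - Y2 w|)%R])%E.
Proof.
move=> [mY1 [s1 [ss1 Es1 cs1]]] [mY2 [s2 [ss2 Es2 cs2]]].
have ms1 k : random_element (s1 k) by case: (ss1 k).
have ms2 k : random_element (s2 k) by case: (ss2 k).
have cvgL : (`|simple_expectation P (s1 k) - simple_expectation P (s2 k)|)%:E
    @[k --> \oo] --> (`|m1 - m2|)%:E.
  apply/cvg_EFin; first by near=> k.
  by apply: cvg_norm; exact: cvgB.
have cvgR : ('E_P[(fun w => `|Y1 w - s1 k w|)%R] +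
    ('E_P[(fun w => `|Y2 w - s2 k w|)%R] + 'E_P[(fun w => `|Y1 w - Y2 w|)%R]))%E
    @[k --> \oo] --> (0 + (0 + 'E_P[(fun w => `|Y1 w - Y2 w|)%R]))%E.
  apply: cvgeD; [exact: fin_num_adde_defr|exact: Es1|].
  apply: cvgeD; [exact: fin_num_adde_defr|exact: Es2|exact: cvg_cst].
rewrite !add0e in cvgR.
rewrite -(cvg_lim _ cvgL)// -(cvg_lim _ cvgR)//.
apply: lee_lim; [by apply/cvg_ex; eexists; exact: cvgL|
  by apply/cvg_ex; eexists; exact: cvgR|].
near=> k; apply: (le_trans (simple_expectation_dist P (ss1 k) (ss2 k))).
have m11 := measurable_fun_normB mY1 (ms1 k).
have m22 := measurable_fun_normB mY2 (ms2 k).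
have m12 := measurable_fun_normB mY1 mY2.
rewrite -expectationD_ge0// -expectationD_ge0//; last exact: measurable_funD.
apply: expectation_le.
- exact: measurable_fun_normB.
- by apply: measurable_funD => //; exact: measurable_funD.
- move=> w; rewrite normr_ge0 /= [leRHS]addrCA.
  have -> : s1 k w - s2 k w = (Y2 w - s2 k w) + ((Y1 w - Y2 w) - (Y1 w - s1 k w)).
    by rewrite opprB !addrA [RHS](ACl (5*2*1*4*3*6))/= !addrK.
  rewrite (le_trans (ler_normD _ _))// lerD2l.
  by rewrite (le_trans (ler_normB _ _))// addrC.
Unshelve. all: by end_near. Qed.

(** The quantizations converge in L^1, so by contraction their expectations form a Cauchy sequence,
    and B is complete. *)
Lemma has_expectation_exists Y : random_element Y ->
  ('E_P[(fun w => `|Y w|)%R] < +oo)%E -> exists m, has_expectation P Y m.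
Proof.
move=> mY Yoo.
have mQ m := measurable_fun_normB mY (random_element_quant m mY).
pose Z m w := quant e m (Y w).
pose D m := 'E_P[(fun w => `|Y w - Z m w|)%R]%E.
have D0 : D m @[m --> \oo] --> 0%E by exact: expectation_dist_quant_cvg.
have sZ m : simple_element (Z m).
  exact: (simple_element_fibers (@measurable_fibers_quant m _ mY)
            (fun a : 'I_m.+1 => e a)).
have seZ : cvgn (fun m => simple_expectation P (Z m)).
  apply: cauchy_cvg; apply: cauchy_exP => eps eps0.
  have /fine_cvgP[Dfin /cvgrPdist_lt/(_ (eps / 2))] := D0.
  rewrite divr_gt0// => /(_ isT) Dsmall.
  have H k l : D k \is a fin_num -> D l \is a fin_num ->
     `|0 - fine (D k)| < eps / 2 -> `|0 - fine (D l)| < eps / 2 ->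
     `|simple_expectation P (Z k) - simple_expectation P (Z l)| < eps.
    move=> fk fl; rewrite !sub0r !normrN => Dk Dl.
    rewrite -lte_fin; apply: le_lt_trans (simple_expectation_dist P (sZ k) (sZ l)) _.
    apply: (@le_lt_trans _ _ (D k + D l)%E).
      rewrite /D -(expectationD_ge0 (mQ k) (mQ l))//; apply: expectation_le.
      - by apply: measurable_fun_normB; exact: random_element_quant.
      - exact: measurable_funD (mQ k) (mQ l).
      - move=> w; rewrite normr_ge0/= -(subrKA (Y w)).
        by rewrite (le_trans (ler_normD _ _))// distrC lerD2r.
    rewrite -(fineK fk) -(fineK fl) -EFinD lte_fin.
    rewrite [ltRHS]splitr ltrD//.
      exact: le_lt_trans (ler_norm _) Dk.
    exact: le_lt_trans (ler_norm _) Dl.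
  near \oo => k.
  have fk : D k \is a fin_num by near: k; exact: Dfin.
  have dk : `|0 - fine (D k)| < eps / 2 by near: k; exact: Dsmall.
  exists (simple_expectation P (Z k)).
  suff : \forall l \near \oo,
    ball (simple_expectation P (Z k)) eps (simple_expectation P (Z l)) by [].
  near=> l.
  have fl : D l \is a fin_num by near: l; exact: Dfin.
  have dl : `|0 - fine (D l)| < eps / 2 by near: l; exact: Dsmall.
  by have := H k l fk fl dk dl; rewrite -ball_normE.
exists (lim (simple_expectation P (Z m) @[m --> \oo])); split=> //.
by exists Z; split.
Unshelve. all: by end_near. Qed.

Lemma second_moment_ge0 X : (0 <= second_moment P X)%E.
Proof. by apply: expectation_ge0 => w; exact: sqr_ge0. Qed.

Lemma second_moment_fin_num X : (second_moment P X < +oo)%E ->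
  second_moment P X \is a fin_num.
Proof. by rewrite ge0_fin_numE// second_moment_ge0. Qed.

End Approximation.

(** * Exit times *)

Section ExitTime.
Context {R : realType} {B : completeNormedModType R}.
Context d (T : measurableType d).
Implicit Types (Xs : nat -> T -> B) (r : R) (n k : nat) (w : T).

Lemma exit_timeE Xs r w K : (1 <= K)%N -> r < `|psum Xs K w| ->
  (forall k, (1 <= k)%N -> r < `|psum Xs k w| -> (K <= k)%N) ->
  exit_time Xs r w = K%:R%:E.
Proof.
move=> K1 rK Kmin; apply/eqP; rewrite eq_le; apply/andP; split.
  by apply: ereal_inf_lbound; exists K.
apply: le_ereal_inf_tmp => _ [k [k1 rk] <-].
by rewrite lee_fin ler_nat Kmin.
Qed.

Lemma exit_time_infty Xs r w :
  (forall k, (1 <= k)%N -> `|psum Xs k w| <= r) -> exit_time Xs r w = +oo%E.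
Proof.
move=> nex; rewrite /exit_time (_ : [set _ | _ in _] = set0) ?ereal_inf0//.
apply/seteqP; split=> // x [k [k1]]; have := nex k k1.
by rewrite leNgt => /negP.
Qed.

Lemma exit_time_case Xs r w :
  (forall k, (1 <= k)%N -> `|psum Xs k w| <= r) \/
  exists K, [/\ (1 <= K)%N, r < `|psum Xs K w| &
    forall k, (1 <= k)%N -> r < `|psum Xs k w| -> (K <= k)%N].
Proof.
have [[k kP]|nk] := pselect (exists k, (1 <= k)%N && (r < `|psum Xs k w|)).
  right; have exk : exists k, (1 <= k)%N && (r < `|psum Xs k w|) by exists k.
  case: (ex_minnP exk) => K /andP[K1 rK] Kmin; exists K; split=> // l l1 rl.
  by apply: Kmin; rewrite l1.
left=> k k1; rewrite leNgt; apply/negP => rk; apply: nk; exists k.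
by rewrite k1.
Qed.

Lemma exit_time_leP Xs r n w : (exit_time Xs r w <= n%:R%:E)%E <->
  exists2 k, (1 <= k <= n)%N & r < `|psum Xs k w|.
Proof.
split.
  have [nex|[K [K1 rK Kmin]]] := exit_time_case Xs r w.
    by rewrite exit_time_infty.
  rewrite (exit_timeE K1 rK Kmin) lee_fin ler_nat => Kn.
  by exists K => //; rewrite K1.
move=> [k /andP[k1 kn] rk]; apply: ge_ereal_inf; exists k%:R%:E; first by exists k.
by rewrite lee_fin ler_nat.
Qed.

Definition survives Xs r n : set T := [set w | (n%:R%:E < exit_time Xs r w)%E].

Lemma survivesE Xs r n :
  survives Xs r n = ~` [set w | (exit_time Xs r w <= n%:R%:E)%E].
Proof.
by apply/seteqP; split=> w; rewrite /survives /= ltNge => /negP.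
Qed.

(** The pointwise tail-sum formula, with both sides infinite when no partial sum leaves the ball.
    The term k = 0 is always 1 because exit takes at least one step. *)
Lemma exit_time_nneseries Xs r w :
  exit_time Xs r w = (\sum_(0 <= k <oo) (\1_(survives Xs r k) w)%:E)%E.
Proof.
have [nex|[K [K1 rK Kmin]]] := exit_time_case Xs r w.
  rewrite exit_time_infty//; apply/esym/eq_infty => x.
  apply: le_trans (nneseries_lim_ge (Num.truncn x).+1 _); last first.
    by move=> k _ _; rewrite lee_fin.
  under eq_bigr.
    move=> k _; rewrite indicE mem_set/=; last first.
      by rewrite /survives/= exit_time_infty// ltry.
    over.
  rewrite sumEFin lee_fin sumr_const_nat subn0.
  exact/ltW/truncnS_gt.
have sE k : \1_(survives Xs r k) w = (k < K)%N%:R :> R.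
  rewrite indicE /survives; case: (ltnP k K) => kK.
    by rewrite mem_set//= (exit_timeE K1 rK Kmin) lte_fin ltr_nat.
  rewrite memNset//= (exit_timeE K1 rK Kmin) lte_fin ltr_nat.
  by apply/negP; rewrite -leqNgt.
rewrite (exit_timeE K1 rK Kmin) (@nneseries_split _ _ 0 K); last first.
  by move=> k _; rewrite lee_fin.
rewrite add0n eseries0 ?adde0; last first.
  by move=> k Kk _; rewrite sE ltnNge Kk.
rewrite big_nat; under eq_bigr.
  by move=> k kK; rewrite sE (_ : (k < K)%N = true)//; over.
by rewrite -big_nat sumEFin sumr_const_nat subn0.
Qed.

Variable P : probability T R.
Variable e : nat -> B.
Hypothesis e_dense : forall b eps, 0 < eps -> exists j, `|b - e j| < eps.

Section FixedSequence.
Variable Xs : nat -> T -> B.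
Hypothesis mXs : forall j, random_element (Xs j).

Lemma measurable_fun_norm_psum k : measurable_fun setT (fun w => `|psum Xs k w|).
Proof. exact: (measurable_fun_norm_sum e_dense (X := fun i : 'I_k => Xs i)). Qed.

Lemma measurable_exit r n :
  measurable [set w | (exit_time Xs r w <= n%:R%:E)%E].
Proof.
rewrite (_ : [set _ | _] = \bigcup_(k in [set k | (1 <= k <= n)%N])
    [set w | r < `|psum Xs k w|]).
  by apply: bigcup_measurable => k _; exact/measurable_set_gt/measurable_fun_norm_psum.
apply/seteqP; split=> [w /= /exit_time_leP[k kn rk]|w [k kn rk]].
  by exists k.
by apply/exit_time_leP; exists k.
Qed.

Lemma measurable_survives r n : measurable (survives Xs r n).
Proof. by rewrite survivesE; apply: measurableC; exact: measurable_exit. Qed.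

Lemma prob_survives r n : P (survives Xs r n) = (1 - exit_prob P Xs r n)%E.
Proof. by rewrite survivesE probability_setC//; exact: measurable_exit. Qed.

Lemma mean_exit_time_nneseries r :
  mean_exit_time P Xs r = (\sum_(0 <= k <oo) P (survives Xs r k))%E.
Proof.
rewrite /mean_exit_time.
under eq_integral do rewrite exit_time_nneseries.
rewrite integral_nneseries//.
  apply: eq_eseriesr => k _; rewrite integral_indic ?setIT//.
  exact: measurable_survives.
by move=> k; apply/measurable_EFinP/measurable_indic; exact: measurable_survives.
Qed.

Lemma mean_exit_time_ge0 r : (0 <= mean_exit_time P Xs r)%E.
Proof. by rewrite mean_exit_time_nneseries; apply: nneseries_ge0. Qed.

Lemma mean_exit_time_ge r n :
  (n%:R%:E * P (survives Xs r n) <= mean_exit_time P Xs r)%E.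
Proof.
rewrite mean_exit_time_nneseries; apply: le_trans (nneseries_lim_ge n _) => //.
apply: (@le_trans _ _ (\sum_(0 <= k < n) P (survives Xs r n))%E).
  have fS : P (survives Xs r n) \is a fin_num.
    by rewrite fin_num_measure//; exact: measurable_survives.
  by rewrite -(fineK fS) sumEFin sumr_const_nat subn0 -EFinM mulr_natl.
rewrite !big_nat; apply: lee_sum => k /andP[_ kn].
apply: le_measure; [by apply: mem_set; exact: measurable_survives..|].
by move=> w /=; apply: le_lt_trans; rewrite lee_fin ler_nat ltnW.
Qed.

(** For n close to 1 / (2 b) the walk survives with probability at least 1/2, and n >= 1 / (4 b):
    their product is 1 / (8 b). *)
Lemma mean_exit_time_ge_inv r (b : R) : 0 < b ->
  (forall n, (1 <= n)%N -> (exit_prob P Xs r n <= (b * n%:R)%:E)%E) ->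
  (((8 * b)^-1)%:E <= mean_exit_time P Xs r)%E.
Proof.
move=> b0 exb.
(* When the claimed bound is at most 1, survival at time 0 is enough; otherwise rounding n down
   costs at most a factor 2. *)
have [b8|b8] := leP (8 * b)^-1 1.
  apply: (@le_trans _ _ 1%E); first by rewrite lee_fin.
  rewrite mean_exit_time_nneseries.
  apply: le_trans (nneseries_lim_ge 1 _) => //.
  rewrite big_nat1 (_ : survives _ _ _ = setT) ?probability_setT//.
  apply/seteqP; split=> // w _; rewrite /survives/= ltNge; apply/negP.
  by move=> /exit_time_leP[k /andP[k1]]; rewrite leqn0 => /eqP k0; rewrite k0 in k1.
pose n := Num.truncn (2 * b)^-1.
have b2 : 0 <= (2 * b)^-1 by rewrite invr_ge0 mulr_ge0// ltW.
have b8' : 8 * b < 1 by rewrite invf_gt1// mulr_gt0 in b8.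
have /andP[nle nge] := truncn_itv b2.
have n_ge : (4 * b)^-1 <= n%:R.
  have : (2 * b)^-1 < n%:R + 1 by rewrite natr1.
  rewrite (_ : (2 * b)^-1 = (4 * b)^-1 + (4 * b)^-1); last by field; rewrite gt_eqF.
  have : 1 <= (4 * b)^-1 by rewrite invf_ge1 ?mulr_gt0//; move: b8'; lra.
  lra.
have n1 : (1 <= n)%N.
  by rewrite -(ltr_nat R) (lt_le_trans _ n_ge)// invr_gt0 mulr_gt0.
have nb : b * n%:R <= 2^-1.
  apply: (@le_trans _ _ (b * (2 * b)^-1)); first by rewrite ler_pM2l.
  by apply/eqW; field; rewrite gt_eqF.
apply: le_trans (mean_exit_time_ge r n).
rewrite prob_survives.
have exn : exit_prob P Xs r n \is a fin_num by rewrite fin_num_measure//; exact: measurable_exit.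
have := exb n n1; rewrite -(fineK exn) lee_fin => H.
rewrite -EFinB -EFinM lee_fin.
apply: (@le_trans _ _ ((4 * b)^-1 * 2^-1)).
  by apply/eqW; field; rewrite gt_eqF.
apply: ler_pM => //; first by rewrite invr_ge0 mulr_ge0// ltW.
lra.
Qed.

End FixedSequence.
End ExitTime.

(** * Truncation *)

Section Truncation.
Context {R : realType} {B : completeNormedModType R}.

Definition trunc (r : R) (b : B) : B := if `|b| <= r then b else 0.

Lemma borel_trunc r A : borel A -> borel (trunc r @^-1` A).
Proof.
pose BT := g_sigma_algebraType (@open B).
move=> bA; suff : @measurable _ BT (trunc r @^-1` A) by [].
have mC : @measurable _ BT [set b | r < `|b|].
  exact: borel_norm_gt.
rewrite (_ : _ @^-1` _ = (~` [set b | r < `|b|] `&` A) `|`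
  ([set b | r < `|b|] `&` (if pselect (A 0) then setT else set0))).
  apply: measurableU; apply: measurableI => //; first exact: measurableC.
  by case: pselect => A0; [exact: measurableT|exact: measurable0].
apply/seteqP; split=> b; rewrite /trunc /=.
  case: leP => rb; first by left; split=> //; rewrite ltNge rb.
  by move=> A0; right; split=> //; case: pselect.
case: leP => rb.
  by move=> [[]|[]].
by move=> [[]|[_]] //; case: pselect.
Qed.

Context d (T : measurableType d) (P : probability T R).
Implicit Types X : T -> B.
Variable e : nat -> B.
Hypotheses (e0 : e 0%N = 0)
  (e_dense : forall b eps, 0 < eps -> exists j, `|b - e j| < eps).

Lemma random_element_trunc r X :
  random_element X -> random_element (fun w => trunc r (X w)).
Proof. by move=> mX; apply: (random_element_comp mX) => A; exact: borel_trunc. Qed.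

Lemma norm_trunc_le r b : 0 <= r -> `|trunc r b| <= r.
Proof. by move=> r0; rewrite /trunc; case: (leP `|b| r); rewrite ?normr0. Qed.

Lemma expectation_bounded (f : T -> R) (M : R) : measurable_fun setT f ->
  (forall w, 0 <= f w <= M) -> ('E_P[f] < +oo)%E.
Proof.
move=> mf fM; apply: (@le_lt_trans _ _ 'E_P[cst M]%E).
  by apply: (expectation_le P mf).
by rewrite expectation_cst ltry.
Qed.

(** The default value 0 in [bochner_expectation] is harmless for [truncM]: a truncated variable is
    bounded and does have an expectation. *)
Lemma has_expectation_trunc r X : 0 < r -> random_element X ->
  has_expectation P (fun w => trunc r (X w)) (r *: Defs.truncM P X r).
Proof.
move=> r0 mX; rewrite /Defs.truncM scalerA divff ?gt_eqF// scale1r.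
rewrite (_ : (fun w => _ *: _) = (fun w => trunc r (X w))); last first.
  apply/funext => w; rewrite /trunc indicE.
  case: leP => wr; first by rewrite mem_set// scale1r.
  by rewrite memNset ?scale0r//=; apply/negP; rewrite -ltNge.
have mt := random_element_trunc r mX.
have [|m hm] := has_expectation_exists e0 e_dense mt (P := P).
  apply: (@expectation_bounded _ r) => [|w].
    exact: (measurable_fun_norm e_dense mt).
  by rewrite normr_ge0 norm_trunc_le// ltW.
by rewrite /bochner_expectation; case: xgetP => [y _ //|/(_ m)].
Qed.

Lemma measurable_norm_gt r X : random_element X ->
  measurable [set w | r < `|X w|].
Proof.
by move=> mX; exact/measurable_set_gt/(measurable_fun_norm e_dense).
Qed.

Lemma measurable_fun_norm_sqr X : random_element X ->
  measurable_fun setT (fun w => `|X w| ^+ 2).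
Proof.
by move=> mX; apply: measurable_funX; exact: (measurable_fun_norm e_dense mX).
Qed.

Lemma truncKE r X : 0 < r -> random_element X ->
  ((r ^+ 2 * Defs.truncK P X r)%:E = 'E_P[(fun w => `|trunc r (X w)| ^+ 2)%R])%E.
Proof.
move=> r0 mX; rewrite /Defs.truncK mulrA divff ?mul1r; last first.
  by rewrite expf_eq0 gt_eqF.
have -> : (fun w => `|X w| ^+ 2 * \1_[set w | `|X w| <= r] w) =
    (fun w => `|trunc r (X w)| ^+ 2).
  apply/funext => w; rewrite /trunc indicE.
  case: leP => wr; first by rewrite mem_set// mulr1.
  rewrite memNset ?mulr0 ?normr0 ?expr0n//=.
  by apply/negP; rewrite -ltNge.
have mt := measurable_fun_norm_sqr (random_element_trunc r mX).
have t0 w : 0 <= `|trunc r (X w)| ^+ 2 <= r ^+ 2.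
  by rewrite sqr_ge0 /= ler_pXn2r ?nnegrE ?norm_trunc_le// ltW.
rewrite fineK// ge0_fin_numE; first exact: (expectation_bounded mt t0).
by rewrite expectationE; apply: integral_ge0 => w _; rewrite lee_fin; case/andP: (t0 w).
Qed.

Lemma tailGE r X : random_element X ->
  (tailG P X r)%:E = P [set w | r < `|X w|].
Proof.
by move=> mX; rewrite /tailG fineK// fin_num_measure//; exact: measurable_norm_gt.
Qed.

Lemma tailG_ge0 r X : 0 <= tailG P X r.
Proof. exact: fine_ge0. Qed.

Lemma truncK_ge0 r X : 0 < r -> random_element X -> 0 <= Defs.truncK P X r.
Proof.
move=> r0 mX; have := truncKE r0 mX.
have : (0 <= 'E_P[(fun w => `|trunc r (X w)| ^+ 2)%R])%E.
  by rewrite expectationE; apply: integral_ge0 => w _; rewrite lee_fin sqr_ge0.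
by move=> /[swap] <-; rewrite lee_fin pmulr_rge0// exprn_gt0.
Qed.

(** If h(r) = 0, the tail confines X to the ball and the truncated second moment makes it vanish
    there, so X = 0 almost surely. Nondegeneracy thus gives c / h(r) its intended meaning. *)
Lemma sumh_gt0 r X : 0 < r -> in_L P X -> 0 < sumh P X r.
Proof.
move=> r0 [mX nX]; rewrite /sumh.
have G0 := tailG_ge0 r X; have K0 := truncK_ge0 r0 mX.
have M0 := normr_ge0 (Defs.truncM P X r).
rewrite ltNge; apply/negP => h0; apply: nX; exists 0.
have GE : tailG P X r = 0 by lra.
have KE : Defs.truncK P X r = 0 by lra.
have mt := measurable_fun_norm_sqr (random_element_trunc r mX).
have tail0 : {ae P, forall w, `|X w| <= r}.
  exists [set w | r < `|X w|]; split; first exact: measurable_norm_gt.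
    by rewrite -tailGE// GE.
  by move=> w /= /negP; rewrite -ltNge.
have trunc0 : {ae P, forall w, setT w -> (`|trunc r (X w)| ^+ 2)%:E = cst 0%E w}.
  apply/(ae_eq_integral_abs P measurableT); first exact/measurable_EFinP.
  under eq_integral do rewrite gee0_abs ?lee_fin ?sqr_ge0//.
  by rewrite -expectationE -truncKE// KE mulr0.
apply: filterS2 tail0 trunc0 => w wr /(_ I) -[/eqP].
by rewrite expf_eq0/= normr_eq0 /trunc wr => /eqP.
Qed.

(** The terms G and K together cost at most E |X|^2. For M, centring replaces the truncated mean by
    minus the mean over |X| > r, where r |X| <= |X|^2; this costs E |X|^2 once more. *)
Lemma sumh_le_second_moment r X : 0 < r -> in_L20 P X ->
  r ^+ 2 * sumh P X r <= 2 * fine (second_moment P X).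
Proof.
move=> r0 [[mX _] X2 EX0].
have mN2 := measurable_fun_norm_sqr mX.
have mt := random_element_trunc r mX.
have mt2 := measurable_fun_norm_sqr mt.
have mXt := measurable_fun_normB e_dense mX mt.
have mI := measurable_norm_gt r mX.
have mI1 : measurable_fun setT (\1_[set w | r < `|X w|] : T -> R).
  exact: measurable_indic.
have X2f := second_moment_fin_num X2.
rewrite -lee_fin [X in (_ <= X)%E]EFinM fineK// /sumh !mulrDr 2!EFinD.
have -> : ((r ^+ 2 * tailG P X r)%:E =
    'E_P[(fun w => r ^+ 2 * \1_[set w | r < `|X w|] w)%R])%E.
  rewrite expectationZ_ge0 ?sqr_ge0//.
  by rewrite expectation_indic// EFinM tailGE.
rewrite truncKE//.
apply: (@le_trans _ _ ('E_P[(fun w => r ^+ 2 * \1_[set w | (r < `|X w|)%R] w)%R]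
    + 'E_P[(fun w => `|trunc r (X w)| ^+ 2)%R]
    + 'E_P[(fun w => r * `|X w - trunc r (X w)|)%R])%E).
  apply: leeD2l; rewrite (expectationZ_ge0 _ (ltW r0) mXt)//.
  rewrite expr2 -mulrA EFinM lee_pmul2l ?lte_fin//.
  have := has_expectation_dist e_dense EX0 (has_expectation_trunc r0 mX).
  by rewrite sub0r normrN normrZ gtr0_norm.
have m1 : measurable_fun setT (fun w => r ^+ 2 * \1_[set w | r < `|X w|] w).
  exact: measurable_funM.
have m3 : measurable_fun setT (fun w => r * `|X w - trunc r (X w)|).
  exact: measurable_funM.
have p1 w : 0 <= r ^+ 2 * \1_[set w | r < `|X w|] w by rewrite mulr_ge0 ?sqr_ge0.
have p3 w : 0 <= r * `|X w - trunc r (X w)| by rewrite mulr_ge0// ltW.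
rewrite -(expectationD_ge0 _ m1 mt2)//.
rewrite -(expectationD_ge0 _ (measurable_funD m1 mt2) m3)//; last first.
  by move=> w; rewrite addr_ge0.
rewrite /second_moment -(expectationZ_ge0 _ _ mN2)//.
apply: expectation_le => [||w].
- by apply: measurable_funD => //; exact: measurable_funD.
- exact: measurable_funM.
apply/andP; split; first by rewrite !addr_ge0.
rewrite /trunc /= indicE; case: (leP `|X w| r) => wr.
  rewrite memNset//=; last by apply/negP; rewrite -leNgt.
  by rewrite mulr0 add0r subrr normr0 mulr0 addr0 ler_peMl ?sqr_ge0// ler1n.
rewrite mem_set//= normr0 subr0 expr0n/= mulr1 addr0.
by have := normr_ge0 (X w); nra.
Qed.

End Truncation.

(** * The implications between the exit-time statements *)

Section Implications.
Context {R : realType} {B : completeNormedModType R}.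
Hypothesis B_sep : separable_space B.

Lemma mean_bound_of_prob_bound (c : R) : 0 < c ->
  exit_prob_bound B c -> exit_mean_bound B (8 * c)^-1.
Proof.
have [e [e0 e_dense]] := separable_dense_seq B_sep.
move=> c0 H d T P X d' T' P' Xs XL iid r r0.
have h0 := sumh_gt0 e_dense r0 XL; have [mXs _ _] := iid.
rewrite (_ : (8 * c)^-1 / sumh P X r = (8 * (c * sumh P X r))^-1); last first.
  by rewrite !invfM !mulrA.
apply: (mean_exit_time_ge_inv e_dense mXs); first exact: mulr_gt0.
by move=> n n1; rewrite mulrAC; exact: (H _ _ _ _ _ _ _ _ XL iid).
Qed.

Lemma asymptotic_mean_of_mean_bound (c : R) : 0 < c ->
  exit_mean_bound B c -> exit_mean_asymptotic_bound B (c / 2).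
Proof.
have [e [e0 e_dense]] := separable_dense_seq B_sep.
move=> c0 H d T P X d' T' P' Xs XL2 iid; have [XL _ _] := XL2.
rewrite limf_einfE; apply: le_ereal_sup_tmp.
eexists; first by exists [set r | 0 < r] => //; exact: nbhs_pinfty_gt.
apply: le_ereal_inf_tmp => _ [r /= r0 <-].
have h0 := sumh_gt0 e_dense r0 XL.
have r2 : 0 < r ^+ 2 by rewrite exprn_gt0.
have hX := sumh_le_second_moment e0 e_dense r0 XL2.
apply: (@le_trans _ _ ((c / sumh P X r)%:E * (r ^- 2)%:E)%E); last first.
  by rewrite lee_pmul2r ?lte_fin ?invr_gt0//; exact: (H _ _ _ _ _ _ _ _ XL iid).
rewrite -EFinM lee_fin -!mulrA ler_pM2l// -!invfM lef_pV2.
- by rewrite mulrC.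
- by rewrite posrE; apply: lt_le_trans hX; rewrite mulr_gt0.
- by rewrite posrE mulr_gt0.
Qed.

Lemma asymptotic_prob_of_prob_bound (c : R) : 0 < c ->
  exit_prob_bound B c -> exit_prob_asymptotic_bound B (2 * c).
Proof.
have [e [e0 e_dense]] := separable_dense_seq B_sep.
move=> c0 H d T P X d' T' P' Xs XL2 iid; have [XL X2 _] := XL2.
rewrite limf_esupE; apply: ge_ereal_inf.
eexists; first by exists [set r | 0 < r] => //; exact: nbhs_pinfty_gt.
apply: ge_ereal_sup => _ [r /= r0 <-]; apply: ge_ereal_sup => _ [n /= n1 <-].
have n0 : 0 < n%:R :> R by rewrite ltr0n.
have r2 : 0 < r ^+ 2 by rewrite exprn_gt0.
have X2f := second_moment_fin_num X2.
rewrite -(fineK X2f) -EFinM.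
apply: (@le_trans _ _ ((r ^+ 2 / n%:R)%:E * (c * n%:R * sumh P X r)%:E)%E).
  rewrite lee_pmul2l ?lte_fin ?divr_gt0//.
  exact: (H _ _ _ _ _ _ _ _ XL iid).
rewrite -EFinM lee_fin.
rewrite [leLHS](_ : _ = c * (r ^+ 2 * sumh P X r)); last by field; rewrite gt_eqF.
rewrite [leRHS](_ : _ = c * (2 * fine (second_moment P X))) ?ler_pM2l//; last by ring.
exact: (sumh_le_second_moment e0 e_dense r0 XL2).
Qed.

Lemma asymptotic_mean_of_asymptotic_prob (c : R) : 0 < c ->
  exit_prob_asymptotic_bound B c -> exit_mean_asymptotic_bound B (16 * c)^-1.
Proof.
have [e [e0 e_dense]] := separable_dense_seq B_sep.
move=> c0 H d T P X d' T' P' Xs XL2 iid; have [XL X2 _] := XL2.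
have [mXs _ _] := iid.
have X2f := second_moment_fin_num X2.
set s := fine (second_moment P X).
have s0 : 0 <= s by exact/fine_ge0/second_moment_ge0.
have mean0 r : (0 <= mean_exit_time P' Xs r * (r ^- 2)%:E)%E.
  rewrite mule_ge0 ?(mean_exit_time_ge0 _ e_dense mXs)//.
  by rewrite lee_fin invr_ge0 sqr_ge0.
rewrite limf_einfE; apply: le_ereal_sup_tmp.
(* At s = 0 the quotient is 0 by the convention for division, and the bound holds trivially. *)
have [sE|sn0] := eqVneq s 0.
  rewrite sE invr0 mulr0; eexists.
    by exists [set r | 0 < r] => //; exact: nbhs_pinfty_gt.
  by apply: le_ereal_inf_tmp => _ [r /= r0 <-].
have {sn0}s0 : 0 < s by rewrite lt_def sn0.
(* The factor 2 makes the inequality strict, so it persists for all large r; with the 8 of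
   [mean_exit_time_ge_inv] it becomes the 16 of the constant. *)
have : (limf_esup (fun r : R => ereal_sup [set (r ^+ 2 / n%:R)%:E *
    exit_prob P' Xs r n | n in [set n : nat | (1 <= n)%N]]) (pinfty_nbhs R)
    < (2 * c * s)%:E)%E.
  apply: (le_lt_trans (H _ _ _ _ _ _ _ _ XL2 iid)).
  rewrite -(fineK X2f) -EFinM lte_fin -/s -mulrA ltr_pMl ?mulr_gt0//.
  by rewrite ltr1n.
rewrite limf_esupE => /ereal_inf_lt[_ [V Vinf <-]] Vlt.
eexists.
  exists (V `&` [set r | 0 < r]) => //; apply: filterI => //.
  exact: nbhs_pinfty_gt.
apply: le_ereal_inf_tmp => _ [r [Vr /= r0] <-].
have r2 : 0 < r ^+ 2 by rewrite exprn_gt0.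
rewrite (_ : (16 * c)^-1 / s = (8 * (2 * c * s / r ^+ 2))^-1 * r ^- 2); last first.
  by field; rewrite !gt_eqF.
rewrite EFinM lee_pmul2r ?lte_fin ?invr_gt0//.
apply: (mean_exit_time_ge_inv e_dense mXs) => [|n n1].
  by rewrite divr_gt0 ?mulr_gt0.
have n0 : 0 < n%:R :> R by rewrite ltr0n.
have : ((r ^+ 2 / n%:R)%:E * exit_prob P' Xs r n <= (2 * c * s)%:E)%E.
  apply/ltW; apply: le_lt_trans Vlt; apply: le_ereal_sup_tmp.
  eexists; first by exists r.
  by apply: ereal_sup_ubound; exists n.
have exn : exit_prob P' Xs r n \is a fin_num.
  by rewrite fin_num_measure//; exact: (measurable_exit e_dense mXs).
rewrite -(fineK exn) -EFinM !lee_fin => rn.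
rewrite -(ler_pM2l (_ : 0 < r ^+ 2 / n%:R)) ?divr_gt0// (le_trans rn)//.
by apply/eqW; field; rewrite !gt_eqF.
Qed.

End Implications.

(** * Independent families *)

Section Independence.
Context {R : realType} {B : completeNormedModType R}.
Context d (T : measurableType d) (P : probability T R).

Lemma independent_comp (I : eqType) (X : I -> T -> B) (f : I -> B -> B) :
  (forall i A, borel A -> borel (f i @^-1` A)) ->
  independent P X -> independent P (fun i w => f i (X i w)).
Proof.
move=> mf indX J A uJ mA.
exact: (indX J (fun i => f i @^-1` A i) uJ (fun i => mf i _ (mA i))).
Qed.

Lemma independent_ord (Xs : nat -> T -> B) n :
  independent P Xs -> independent P (fun i : 'I_n => Xs i).
Proof.
pose BT := g_sigma_algebraType (@open B).
move=> indX J A uJ mA.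
pose A' k := if insub k is Some i then A i else setT.
have A'E (i : 'I_n) : A' i = A i by rewrite /A' valK.
have mA' k : borel (A' k).
  rewrite /A'; case: insubP => [i _ _|_]; first exact: mA.
  by change (@measurable _ BT setT); exact: measurableT.
have uJ' : uniq (map val J) by rewrite map_inj_uniq//; exact: val_inj.
have := indX (map val J) A' uJ' mA'; rewrite big_map.
rewrite (_ : \bigcap_(i in [set` J]) (Xs i @^-1` A i) =
  \bigcap_(k in [set` map val J]) (Xs k @^-1` A' k)).
  by move=> ->; apply: eq_bigr => i _; rewrite A'E.
apply/seteqP; split=> w AX k /=.
  by move=> /mapP[i iJ ->]; rewrite A'E; exact: AX.
by move=> kJ; rewrite -A'E; apply: (AX k) => /=; apply/mapP; exists k.
Qed.

Variables (n : nat) (X : 'I_n -> T -> B).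
Hypotheses (mX : forall i, random_element (X i)) (indX : independent P X).
Context {F : finType} (q : B -> F).
Hypothesis mq : forall A : set F, borel (q @^-1` A).

Lemma measurable_fibers_comp i : measurable_fibers (fun w => q (X i w)).
Proof. by move=> a; exact: (mX i (mq [set a])). Qed.

Lemma mass_ffun v : mass P (fun w => [ffun i => q (X i w)]) v =
  prodw (fun i => mass P (fun w => q (X i w))) v.
Proof.
rewrite /mass /prodw.
have := indX (index_enum_uniq _) (fun i => mq [set v i]).
rewrite (_ : \bigcap_(i in _) _ = (fun w => [ffun i => q (X i w)]) @^-1` [set v]).
  move=> ->; rewrite (_ : \big[*%E/1%E]_(i <- _) _ =
    (\prod_i mass P (fun w => q (X i w)) (v i))%:E)//.
  elim/big_ind2 : _ => // [? x ? y -> ->|i _]; first by rewrite EFinM.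
  exact: (massE P (@measurable_fibers_comp i) (v i)).
apply/seteqP; split=> [w Xv|w /= <- i _ /=]; last by rewrite ffunE.
by apply/ffunP => i; rewrite ffunE; apply: Xv; rewrite /= mem_index_enum.
Qed.

Lemma expectation_ffun (g : {ffun 'I_n -> F} -> R) : (forall v, 0 <= g v) ->
  ('E_P[(fun w => g [ffun i => q (X i w)])] =
   (\sum_v prodw (fun i => mass P (fun w => q (X i w))) v * g v)%:E)%E.
Proof.
move=> g0; have mQ := measurable_fibers_ffun measurable_fibers_comp.
rewrite expectationE (expectation_fibers P mQ g0).
by congr EFin; apply: eq_bigr => v _; rewrite mass_ffun.
Qed.

Lemma prob_ffun (A : pred {ffun 'I_n -> F}) :
  P [set w | A [ffun i => q (X i w)]] =
  (\sum_v prodw (fun i => mass P (fun w => q (X i w))) v * (A v)%:R)%:E.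
Proof.
have mQ := measurable_fibers_ffun measurable_fibers_comp.
rewrite (prob_fibers P mQ A).
by congr EFin; apply: eq_bigr => v _; rewrite mass_ffun.
Qed.

(** Type 2 is a statement about random elements; applied to functions of the labels of [X] it
    becomes an inequality between finite weighted sums. *)
Lemma type2_ffun (c : R) (z : 'I_n -> F -> B) : type2 B c -> (1 <= n)%N ->
  (forall i, \sum_a mass P (fun w => q (X i w)) a *: z i a = 0) ->
  \sum_v prodw (fun i => mass P (fun w => q (X i w))) v *
    `|\sum_i z i (v i)| ^+ 2
  <= c * \sum_i \sum_a mass P (fun w => q (X i w)) a * `|z i a| ^+ 2.
Proof.
move=> t2 n1 z0.
have sm i : (second_moment P (fun w => z i (q (X i w))) =
    (\sum_a mass P (fun w => q (X i w)) a * `|z i a| ^+ 2)%:E)%E.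
  rewrite /second_moment expectationE.
  exact: (expectation_fibers P (@measurable_fibers_comp i)
    (fun a => sqr_ge0 `|z i a|)).
have := t2 d T P n (fun i w => z i (q (X i w))) n1.
have -> : second_moment P (fun w => \sum_i z i (q (X i w))) =
    (\sum_v prodw (fun i => mass P (fun w => q (X i w))) v *
    `|\sum_i z i (v i)| ^+ 2)%:E.
  rewrite -(expectation_ffun (g := fun v => `|\sum_i z i (v i)| ^+ 2))//.
  rewrite /second_moment; congr expectation; apply/funext => w.
  by congr (`|_| ^+ 2); apply: eq_bigr => i _; rewrite ffunE.
have -> : (\sum_i second_moment P (fun w => z i (q (X i w))) =
    (\sum_i \sum_a mass P (fun w => q (X i w)) a * `|z i a| ^+ 2)%:E)%E.
  by rewrite -sumEFin; apply: eq_bigr => i _; exact: sm.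
rewrite -EFinM lee_fin; apply.
- by move=> i; case: (simple_element_fibers (@measurable_fibers_comp i) (z i)).
- apply: (independent_comp (f := fun i b => z i (q b))) => // i A _.
  exact: (mq (fun a => A (z i a))).
- move=> i; rewrite -(z0 i); apply: has_expectation_fibers.
  exact: measurable_fibers_comp.
- by move=> i; rewrite sm ltry.
Qed.

End Independence.

(** * Type 2 implies the exit probability bound *)

Section ProbBoundOfType2.
Context {R : realType} {B : completeNormedModType R}.

Lemma markov_ge0 d (T : measurableType d) (P : probability T R) (f : T -> R)
    (a : R) : 0 <= a -> measurable_fun setT f -> (forall w, 0 <= f w) ->
  (a%:E * P [set w | (a <= f w)%R] <= 'E_P[f])%E.
Proof.
move=> a0 mf f0.
have mA := measurable_set_ge a mf.
have mA1 : measurable_fun setT (\1_[set w | (a <= f w)%R] : T -> R).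
  exact: measurable_indic.
rewrite -(expectation_indic P mA) -expectationZ_ge0//.
apply: expectation_le => // [|w]; first exact: measurable_funM.
rewrite mulr_ge0//= indicE; case: (leP a (f w)) => aw.
  by rewrite mem_set// mulr1.
by rewrite memNset ?mulr0//=; apply/negP; rewrite -ltNge.
Qed.

(* Chebyshev's inequality and type 2 for the tail sums feed Ottaviani's
   inequality with t = r / 4. *)
Lemma type2_maximal d (T : measurableType d) (P : probability T R) (n : nat)
    (X : 'I_n -> T -> B) (F : finType) (q : B -> F) (y : F -> B) (p : F -> R)
    (c r K : R) :
  0 < c -> type2 B c -> (1 <= n)%N -> 0 < r ->
  (forall i, random_element (X i)) -> independent P X ->
  (forall A : set F, borel (q @^-1` A)) ->
  (forall i, mass P (fun w => q (X i w)) = p) ->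
  \sum_a p a * `|y a| ^+ 2 <= 4 * r ^+ 2 * K ->
  512 * c * n%:R * K <= 1 ->
  (P [set w | [exists k : 'I_n.+1, (2 * (r / 4) < `|partial_sum
    (fun _ a => (y a - \sum_b p b *: y b)%R) [ffun i => q (X i w)] k|)%R]]
   <= (512 * c * n%:R * K)%:E)%E.
Proof.
set q512 := 512 * c; have qE : q512 = 512 * c by [].
clearbody q512; move=> c0 t2 n1 r0 mX indX mq pE yK cnK.
rewrite (prob_ffun mX indX mq (fun v => [exists k : 'I_n.+1, 2 * (r / 4) <
  `|partial_sum (fun _ a => y a - \sum_b p b *: y b) v k|])) lee_fin.
set w := prodw _; pose mu := \sum_b p b *: y b.
pose z (i : 'I_n) a := y a - mu.
have wE : w = prodw (fun _ => p).
  by apply/funext => v; rewrite /w; congr prodw; apply/funext => i; rewrite pE.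
have i0 : 'I_n by exact: Ordinal n1.
have p0 a : 0 <= p a by rewrite -(pE i0) mass_ge0.
have p1 : \sum_a p a = 1.
  by rewrite -(pE i0) sum_mass//; exact: (measurable_fibers_comp mX mq).
have w0 v : 0 <= w v by rewrite wE prodw_ge0.
(* Centring costs 2 (4 + 4) = 16, the second 4 being Jensen's bound for the squared mean. *)
have var : \sum_a p a * `|y a - mu| ^+ 2 <= 16 * r ^+ 2 * K.
  apply: (@le_trans _ _ (\sum_a (2 * (p a * `|y a| ^+ 2)
      + p a * (2 * `|mu| ^+ 2)))).
    apply: ler_sum => a _.
    rewrite [leRHS](_ : _ = p a * (2 * (`|y a| ^+ 2 + `|mu| ^+ 2))); last by ring.
    rewrite ler_wpM2l//.
    exact: sqr_normB_le.
  rewrite big_split/= -mulr_sumr -mulr_suml p1 mul1r.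
  have := sqr_norm_convex y p0 p1; rewrite -/mu.
  by move: yK; clear; lra.
(* Chebyshev's inequality at level r / 4 multiplies 16 by 16. Summands before k are replaced by 0,
   so that type 2 applies to all n of them at once. *)
have tails k : \sum_v w v * (r / 4 < `|tail_sum z v k|)%R%:R <=
    256 * c * n%:R * K.
  pose z' (i : 'I_n) a := if (k <= i)%N then z i a else 0.
  have z'0 i : \sum_a mass P (fun w => q (X i w)) a *: z' i a = 0.
    rewrite pE /z'; case: (k <= i)%N; last first.
      by rewrite big1// => a _; rewrite scaler0.
    under eq_bigr do rewrite /z scalerBr.
    by rewrite sumrB -scaler_suml p1 scale1r subrr.
  have := type2_ffun mX indX mq t2 n1 z'0; rewrite -/w => T2.
  have r4 : 0 < r / 4 by rewrite divr_gt0.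
  rewrite -(ler_pM2l (_ : 0 < (r / 4) ^+ 2)) ?exprn_gt0//.
  rewrite mulr_sumr.
  apply: (@le_trans _ _ (\sum_v w v * `|\sum_i z' i (v i)| ^+ 2)).
    apply: ler_sum => v _; rewrite mulrCA ler_wpM2l//.
    rewrite /tail_sum big_mkcond/=.
    case: ltP => rz; rewrite ?mulr1 ?mulr0 ?sqr_ge0//.
    by rewrite ler_pXn2r ?nnegrE ?(ltW rz)// ltW.
  apply: (le_trans T2).
  apply: (@le_trans _ _ (c * \sum_(i < n) (16 * r ^+ 2 * K))).
    rewrite ler_pM2l// ler_sum// => i _; rewrite pE.
    apply: le_trans var; apply: ler_sum => a _; rewrite ler_wpM2l//.
    by rewrite /z'; case: ifP => // _; rewrite normr0 expr0n sqr_ge0.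
  rewrite sumr_const card_ord -[_ *+ n]mulr_natl.
  by apply/eqW; field.
have := @ottaviani R B F n (fun _ => p) (fun _ => p0) (fun _ => p1) z (r / 4).
rewrite -wE; move=> /(_ _)/le_trans; apply.
  by move=> k; apply: (le_trans (tails k)); move: cnK; rewrite qE; clear; lra.
(* The full sum is the tail sum from 0; Ottaviani's factor 2 turns 256 into 512. *)
have := tails 0%N.
have -> : \sum_v w v * (r / 4 < `|tail_sum z v 0|)%R%:R =
    \sum_v w v * (r / 4 < `|partial_sum z v n|)%R%:R.
  apply: eq_bigr => v _; rewrite (partial_sum_tail z v 0) [partial_sum z v 0]big1//.
  by rewrite add0r.
by rewrite qE; clear; lra.
Qed.

End ProbBoundOfType2.

Section ProbBoundOfType2Main.
Context {R : realType} {B : completeNormedModType R}.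
Hypothesis B_sep : separable_space B.

(* Nothing is to be proved unless n h(r) < 1 / (8 + 512 c). In that case the
   truncated variables are quantized, their means sum to at most r / 4 and the
   maximal inequality applies to the recentred sums. *)
Lemma prob_bound_of_type2 (c : R) : 0 < c ->
  type2 B c -> exit_prob_bound B (8 + 512 * c).
Proof.
have [e [e0 e_dense]] := separable_dense_seq B_sep.
move=> c0 t2; set q512 := 512 * c.
have q0 : 0 <= q512 by rewrite mulr_ge0 ?ler0n ?(ltW c0).
have qE : q512 = 512 * c by [].
clearbody q512 => d T P X d' T' P' Xs XL iid r n r0 n1.
have [mX _] := XL; have [mXs lawXs indXs] := iid.
have n0 : 0 < n%:R :> R by rewrite ltr0n.
have G0 := tailG_ge0 P r X; have K0 := truncK_ge0 P e_dense r0 mX.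
have M0 := normr_ge0 (Defs.truncM P X r).
set h := sumh P X r; have hE : h = tailG P X r + Defs.truncK P X r + `|Defs.truncM P X r| by [].
have h0 : 0 <= h by rewrite hE !addr_ge0.
have [nh|nh] := leP 1 ((8 + q512) * n%:R * h).
  apply: (@le_trans _ _ 1%E); last by rewrite lee_fin.
  by apply: probability_le1; exact: (measurable_exit e_dense mXs).
(* The slack eps pays for quantization. The tail and second-moment terms are smaller than the claim,
   where the summand 8 guarantees n h(r) <= 1/8 and so controls the drift. *)
suff small eps : 0 < eps ->
    (exit_prob P' Xs r n <= (n%:R * tailG P X r
       + q512 * n%:R * Defs.truncK P X r + eps)%:E)%E.
  apply: (@le_trans _ _ (n%:R * tailG P X r
       + q512 * n%:R * Defs.truncK P X r)%:E).
    by apply/lee_addgt0Pr => eps eps0; rewrite -EFinD; exact: small.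
  rewrite lee_fin hE.
  set nG := tailG P X r in G0 *; set nK := Defs.truncK P X r in K0 *.
  set nM := `|_| in M0 *.
  have -> : (8 + q512) * n%:R * (nG + nK + nM) =
     (n%:R * nG + q512 * n%:R * nK) +
     (n%:R * (7 * nG + 8 * nK + 8 * nM) + q512 * n%:R * (nG + nM)) by ring.
  rewrite lerDl; apply: addr_ge0; first by rewrite mulr_ge0// !addr_ge0// mulr_ge0.
  by rewrite !mulr_ge0 ?addr_ge0.
move=> eps0.
have bt A : borel A -> borel (@trunc R B r @^-1` A) by exact: borel_trunc.
pose Y j w := trunc r (Xs j w).
have mY j : random_element (Y j) by exact: (random_element_trunc r (mXs j)).
have mt : random_element (fun w => trunc r (X w)) by exact: random_element_trunc.
have bounded d1 (T1 : measurableType d1) (P1 : probability T1 R) (Z : T1 -> B) :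
    random_element Z -> (forall w, `|Z w| <= r) -> ('E_P1[(fun w => `|Z w|)%R] < +oo)%E.
  move=> mZ Zr; apply: (@expectation_bounded _ _ _ _ _ r) => [|w].
    exact: (measurable_fun_norm e_dense mZ).
  by rewrite normr_ge0 Zr.
have tr (b : B) : `|trunc r b| <= r by rewrite norm_trunc_le// ltW.
pose D m j w := `|Y j w - quant e m (Y j w)|.
have mD m j : measurable_fun setT (D m j).
  exact: (measurable_fun_normB e_dense (mY j) (random_element_quant e m (mY j))).
pose qx m b := quant_index e m (trunc r b).
have mqx m A : borel (qx m @^-1` A) by exact: bt (borel_quant_index e A).
pose p m := mass P (fun w => qx m (X w)).
pose mu m := \sum_a p m a *: e a.
have muE m : has_expectation P (fun w => quant e m (trunc r (X w))) (mu m).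
  apply: (has_expectation_fibers P (Q := fun w => qx m (X w)) _ (fun a => e (a : 'I_m.+1))).
  by move=> a; exact: (mX _ (mqx m [set a])).
pose ms : B := r *: Defs.truncM P X r.
have msE := has_expectation_trunc P e0 e_dense r0 mX.
(* The mesh is fine enough that n means move by at most r / 8 in all, and that the summed errors
   exceed r / 4 with probability at most eps. *)
have [m [muC DC]] : exists m, `|ms - mu m| * n%:R <= r / 8 /\
    forall j : 'I_n, ('E_P'[D m j] <= (eps * r / (4 * n%:R))%:E)%E.
  have mtoo := bounded _ _ P _ mt (fun w => tr (X w)).
  have c1 : \forall m \near \oo,
      ('E_P[(fun w => `|trunc r (X w) - quant e m (trunc r (X w))|)%R] <
       (r / 8 / n%:R)%:E)%E.
    by apply: expectation_dist_quant_lt => //; rewrite !divr_gt0.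
  have c2 : \forall m \near \oo, forall j : 'I_n,
      ('E_P'[D m j] < (eps * r / (4 * n%:R))%:E)%E.
    apply: filter_forall => j; apply: expectation_dist_quant_lt => //.
      by apply: bounded => // w; exact: tr.
    by rewrite divr_gt0 ?mulr_gt0.
  near \oo => m; exists m; split; last first.
    move=> j; apply/ltW; move: j; near: m; exact: c2.
  rewrite -ler_pdivlMr// -lee_fin.
  apply: (le_trans (has_expectation_dist e_dense msE (muE m))).
  by apply/ltW; near: m; exact: c1.
pose Q j w := qx m (Xs j w).
have massQ j : mass P' (Q j) = p m.
  apply/funext => a; rewrite /mass /p /mass; congr fine.
  exact: (lawXs j _ (mqx m [set a])).
pose K := Defs.truncK P X r.
have pK : \sum_a p m a * `|e a| ^+ 2 <= 4 * r ^+ 2 * K.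
  have mQ : measurable_fibers (fun w => qx m (X w)).
    by move=> a; exact: (mX _ (mqx m [set a])).
  have := expectation_fibers P mQ (fun a : 'I_m.+1 => sqr_ge0 `|e a|).
  rewrite -lee_fin => /= <-.
  rewrite -mulrA EFinM (truncKE P e_dense r0 mX) -expectationZ_ge0//; last first.
    exact: (measurable_fun_norm_sqr e_dense mt).
  rewrite -expectationE; apply: expectation_le => [||w].
  - exact: (measurable_fun_fibers mQ (fun a : 'I_m.+1 => `|e a| ^+ 2)).
  - apply: measurable_funM => //; exact: (measurable_fun_norm_sqr e_dense mt).
  - rewrite sqr_ge0/= (_ : 4 = 2 ^+ 2); last by ring.
    rewrite -exprMn ler_pXn2r ?nnegrE// ?mulr_ge0//.
    exact: (norm_quant_le e0).
have Kh : K <= h by rewrite hE addrAC lerDr addr_ge0.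
have nh' : n%:R * (8 + q512) * h <= 1 by rewrite (mulrC n%:R) ltW.
have cnK : q512 * n%:R * K <= 1.
  apply: le_trans nh'; rewrite [q512 * _]mulrC -!mulrA ler_pM2l//.
  by apply: ler_pM => //; rewrite lerDr.
have n8 : n%:R * h * 8 <= 1.
  apply: le_trans nh'; rewrite mulrAC ler_wpM2r// ler_wpM2l ?(ltW n0)//.
  by rewrite lerDl.
have nM : n%:R * `|ms| <= r / 8.
  rewrite normrZ gtr0_norm// mulrCA ler_pM2l//.
  rewrite -ler_pdivlMr// div1r in n8.
  by apply: le_trans n8; rewrite ler_pM2l// hE lerDr addr_ge0.
have nmu : n%:R * `|mu m| <= r / 4.
  have : `|mu m| <= `|ms| + `|ms - mu m|.
    by rewrite -{1}[mu m](subKr ms) (le_trans (ler_normB _ _)).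
  rewrite -(ler_pM2l n0) mulrDr [X in _ + X]mulrC.
  by move: muC nM; clear; lra.
pose A := \big[setU/set0]_(j < n) [set w | r < `|Xs j w|].
pose S w := \sum_(j < n) D m j w.
pose z (i : 'I_n) (a : 'I_m.+1) := e a - \sum_b p m b *: e b.
pose C := [set w | [exists k : 'I_n.+1, 2 * (r / 4) <
  `|partial_sum z [ffun i : 'I_n => qx m (Xs i w)] k|]].
have mS : measurable_fun setT S.
  by rewrite /S; apply: measurable_sum => j; exact: mD.
have mA : measurable A.
  by apply: bigsetU_measurable => j _; exact: (measurable_norm_gt e_dense r (mXs j)).
have mBs := measurable_set_ge (r / 4) mS.
have indn := independent_ord (n := n) indXs.
have mC : measurable C.
  have mQ := measurable_fibers_ffun (measurable_fibers_comp
    (fun i : 'I_n => mXs i) (mqx m)).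
  exact: (measurable_fiber_preimage mQ (fun v => [exists k : 'I_n.+1, 2 * (r / 4) <
    `|partial_sum z v k|])).
(* With no jump beyond r, the walk equals the recentred quantized sum plus errors and drift. The
   latter two take at most r / 4 each, so an exit forces the recentred sum beyond r / 2. *)
have cover : [set w | (exit_time Xs r w <= n%:R%:E)%E] `<=`
    A `|` ([set w | r / 4 <= S w] `|` C).
  move=> w /= /exit_time_leP[k /andP[k1 kn] rk].
  have [[j rj]|small] := pselect (exists j : 'I_n, r < `|Xs j w|).
    left; rewrite /A -(bigcup_mkord n (fun j => [set w | r < `|Xs j w|])).
    by exists (j : nat) => //=.
  right; have [rS|rS] := leP (r / 4) (S w); [by left|right].
  rewrite /C/=; apply/existsP; exists (inord k).
  rewrite inordK ?ltnS// /partial_sum /z.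
  have YE (j : 'I_n) : Y j w = Xs j w.
    by rewrite /Y /trunc; case: (leP `|Xs j w| r) => // rj; case: small; exists j.
  have psumE : psum Xs k w = \sum_(i < n | (i < k)%N) Y i w.
    rewrite /psum (big_ord_widen _ (fun j => Xs j w) kn).
    by apply: eq_bigr => i _; rewrite YE.
  have sumE : \sum_(i < n | (i < k)%N)
      (e ([ffun i : 'I_n => qx m (Xs i w)] i) - mu m) =
    psum Xs k w - \sum_(i < n | (i < k)%N) (Y i w - quant e m (Y i w))
      - \sum_(i < n | (i < k)%N) mu m.
    rewrite psumE -!sumrB; apply: eq_bigr => i _; rewrite ffunE.
    by rewrite subKr.
  rewrite sumE; set s1 := \sum_(i < n | (i < k)%N) (Y i w - _).
  set s2 := \sum_(i < n | _) _.
  have s1S : `|s1| <= S w.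
    rewrite (le_trans (ler_norm_sum _ _ _))// /S [leRHS](bigID (fun i : 'I_n => (i < k)%N))/=.
    apply: ler_wpDr; first by apply: sumr_ge0 => i _; exact: normr_ge0.
    exact: lexx.
  have s2n : `|s2| <= n%:R * `|mu m|.
    rewrite (le_trans (ler_norm_sum _ _ _))//.
    rewrite mulr_natl -[X in _ *+ X]card_ord -sumr_const big_mkcond/=.
    by apply: ler_sum => i _; case: ifP.
  have := ler_normD (psum Xs k w - s1 - s2) (s2 + s1).
  rewrite addrA !subrK; have := ler_normD s2 s1.
  by move: s1S s2n rS rk nmu; clear; lra.
have PA : (P' A <= (n%:R * tailG P X r)%:E)%E.
  have mj j : measurable [set w | r < `|Xs j w|].
    exact: (measurable_norm_gt e_dense r (mXs j)).
  apply: (le_trans (Boole_inequality P' (fun j _ => mj j))).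
  rewrite mulr_natl -[X in _ *+ X]card_ord -sumr_const -sumEFin.
  apply: lee_sum => j _; rewrite (tailGE P e_dense r mX).
  rewrite -(lawXs j [set b | r < `|b|])//; exact: borel_norm_gt.
have PB : (P' [set w | (r / 4 <= S w)%R] <= eps%:E)%E.
  have r4 : 0 < r / 4 by rewrite divr_gt0.
  have D0 w : 0 <= S w by rewrite /S sumr_ge0// => j _; exact: normr_ge0.
  have := markov_ge0 P' (ltW r4) mS D0.
  have ES : ('E_P'[S] <= (r / 4 * eps)%:E)%E.
    rewrite expectationE /S.
    under eq_integral do rewrite -sumEFin.
    rewrite ge0_integral_sum//=; last 2 first.
      by move=> j; apply/measurable_EFinP; exact: mD.
      by move=> j w _; rewrite lee_fin; exact: normr_ge0.
    apply: (@le_trans _ _ (\sum_(j < n) (eps * r / (4 * n%:R))%:E)%E).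
      by apply: lee_sum => j _; rewrite -expectationE; exact: DC.
    rewrite sumEFin sumr_const card_ord -[_ *+ n]mulr_natl lee_fin.
    by apply/eqW; field; rewrite gt_eqF.
  by move=> /le_trans/(_ ES); rewrite (EFinM (r / 4)) lee_pmul2l// lte_fin.
have PC : (P' C <= (q512 * n%:R * K)%:E)%E.
  rewrite qE in cnK *; exact: (type2_maximal c0 t2 n1 r0 (fun i : 'I_n => mXs i)
    indn (mqx m) (fun i => massQ i) pK cnK).
rewrite /exit_prob.
apply: (@le_trans _ _ (P' A + (P' [set w | (r / 4 <= S w)%R] + P' C))%E).
  have mU : measurable ([set w | r / 4 <= S w] `|` C) by exact: measurableU.
  apply: (@le_trans _ _ (P' (A `|` ([set w | r / 4 <= S w] `|` C)))).
    apply: le_measure => //; apply: mem_set; last exact: measurableU.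
    exact: (measurable_exit e_dense mXs).
  apply: (le_trans (measureU2 _ mA mU)); apply: leeD2l.
  exact: measureU2.
rewrite -addrA [X in (n%:R * _ + X)%R]addrC !EFinD.
by apply: leeD => //; exact: leeD.
Unshelve. all: by end_near. Qed.
End ProbBoundOfType2Main.

(** * The Rademacher form of type 2 *)

Section Type2OfRademacher.
Context {R : realType} {B : completeNormedModType R}.
Hypothesis B_sep : separable_space B.

Lemma limn_einf_le (u : nat -> \bar R) (b : \bar R) :
  (forall n, (u n <= b)%E) -> (limn_einf u <= b)%E.
Proof.
move=> ub; rewrite limn_einf_lim; apply: lime_le; first exact: is_cvg_einfs.
near=> n; apply: le_trans (ub n); apply: ereal_inf_lbound.
by exists n => /=.
Unshelve. all: by end_near. Qed.

(* The finite symmetrization applies to the quantized variables, recentred by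
   their means, which tend to 0; Fatou's lemma passes to the limit. *)
Lemma type2_of_rademacher (K : R) : 0 <= K ->
  (forall n (x : 'I_n -> B), wavg n (fun s => `|signed_sum x s| ^+ 2)
     <= K * \sum_i `|x i| ^+ 2) ->
  type2 B (16 * K).
Proof.
have [e [e0 e_dense]] := separable_dense_seq B_sep.
move=> K0 rad d T P n X n1 mX indX X0 X2.
pose q m := quant_index e m.
have mq m (A : set 'I_m.+1) : borel (q m @^-1` A) by exact: borel_quant_index.
pose p m i := mass P (fun w => q m (X i w)).
pose mu m i := \sum_a p m i a *: e a.
have mQ m i : measurable_fibers (fun w => q m (X i w)) by exact: measurable_fibers_quant.
have mN2 i := measurable_fun_norm_sqr e_dense (mX i).
have X1 i : ('E_P[(fun w => `|X i w|)%R] < +oo)%E.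
  apply: (@le_lt_trans _ _ ('E_P[(fun w => 1 + `|X i w| ^+ 2)%R])%E).
    apply: expectation_le; first exact: (measurable_fun_norm e_dense).
      exact: measurable_funD.
    move=> w; rewrite normr_ge0 /=.
    have := normr_ge0 (X i w); move: `|X i w| => x x0.
    by have := sqr_ge0 (x - 1); clear -x0; nra.
  rewrite (expectationD_ge0 P (measurable_cst (1 : R)) (mN2 i))//.
  by rewrite expectation_cst; apply: lte_add_pinfty; [exact: ltry|exact: X2].
have mu0 i : mu m i @[m --> \oo] --> 0.
  apply/cvgrPdist_lt => eps eps0.
  apply: filterS (expectation_dist_quant_lt e0 e_dense (P := P) (mX i) (X1 i) eps0) => m small.
  rewrite -lte_fin; apply: le_lt_trans small.
  exact: (has_expectation_dist e_dense (X0 i)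
    (has_expectation_fibers P (mQ m i) (fun a : 'I_m.+1 => e a))).
pose f m w := `|\sum_i (quant e m (X i w) - mu m i)| ^+ 2.
have fE m w : f m w = `|\sum_i (e ([ffun i => q m (X i w)] i) - mu m i)| ^+ 2.
  by congr (`|_| ^+ 2); apply: eq_bigr => i _; rewrite ffunE.
pose g m (v : {ffun 'I_n -> 'I_m.+1}) := `|\sum_i (e (v i) - mu m i)| ^+ 2.
have g0 m v : 0 <= g m v by exact: sqr_ge0.
have mf m : measurable_fun setT (f m).
  have := measurable_fun_fibers (measurable_fibers_ffun (mQ m)) (g m).
  by apply: eq_measurable_fun => w _; rewrite fE.
pose s i := fine (second_moment P (X i)).
have sE i : second_moment P (X i) = (s i)%:E.
  by rewrite fineK// second_moment_fin_num.
have -> : (\sum_(i < n) second_moment P (X i) = (\sum_i s i)%:E)%E.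
  by rewrite -sumEFin; apply: eq_bigr => i _; exact: sE.
rewrite -EFinM.
have bound m : ('E_P[f m] <= (16 * K * \sum_i s i)%:E)%E.
  rewrite (_ : f m = fun w => g m [ffun i => q m (X i w)]); last first.
    by apply/funext => w; rewrite fE.
  rewrite (expectation_ffun mX indX (mq m) (g0 m)).
  have p0 i a : 0 <= p m i a by exact: mass_ge0.
  have p1 i : \sum_a p m i a = 1 by rewrite sum_mass.
  rewrite lee_fin.
  apply: le_trans (sum_prodw_symm p0 p1 (fun _ (a : 'I_m.+1) => e a) K0 (rad n)) _.
  (* One factor 4 comes from symmetrization, the other from |quant| <= 2 |b|. *)
  have -> : 16 * K * \sum_i s i = 4 * K * \sum_i (4 * s i).
    by rewrite -mulr_sumr; ring.
  rewrite ler_wpM2l ?mulr_ge0// ler_sum// => i _.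
  have := expectation_fibers P (mQ m i) (fun a : 'I_m.+1 => sqr_ge0 `|e a|).
  rewrite -lee_fin => /= <-; rewrite EFinM -sE -expectationZ_ge0// -expectationE.
  apply: expectation_le => [||w].
  - exact: (measurable_fun_fibers (mQ m i) (fun a : 'I_m.+1 => `|e a| ^+ 2)).
  - exact: measurable_funM.
  - rewrite sqr_ge0/= (_ : 4 = 2 ^+ 2); last by ring.
    rewrite -exprMn ler_pXn2r ?nnegrE// ?mulr_ge0//.
    exact: (norm_quant_le e0).
have fcvg w : (f m w)%:E @[m --> \oo] --> (`|\sum_i X i w| ^+ 2)%:E.
  apply/cvg_EFin; first by near=> m.
  have c : `|\sum_i (quant e m (X i w) - mu m i)| @[m --> \oo] --> `|\sum_i X i w|.
    apply: cvg_norm; apply: cvg_big => [|i _]; first exact: add_continuous.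
    rewrite -[X in _ --> X]subr0; apply: cvgB; last exact: mu0.
    exact: quant_cvg.
  exact: (cvgM c c).
rewrite /second_moment expectationE.
under eq_integral do rewrite -(cvg_limn_einf_sup (fcvg _)).1.
apply: (le_trans (fatou P measurableT _ _)).
- by move=> m; apply/measurable_EFinP.
- by move=> m w _; rewrite lee_fin sqr_ge0.
- by apply: limn_einf_le => m; rewrite -expectationE.
Unshelve. all: by end_near. Qed.

End Type2OfRademacher.

(** * Independent uniform letters *)

Lemma wavg_tuple (R : realType) (F : finType) n (g : seq F -> R) :
  wavg n g = #|F|%:R ^- n * \sum_(t : n.-tuple F) g t.
Proof.
elim: n g => [|n IHn] g.
  rewrite /= expr0 invr1 mul1r (big_pred1 [tuple])// => t.
  by apply/esym/eqP; exact: tuple0.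
rewrite /=; under eq_bigr do rewrite IHn.
rewrite -mulr_sumr mulrA -invfM -exprS; congr (_ * _).
rewrite pair_big/=.
rewrite (reindex (fun t : n.+1.-tuple F => (thead t, [tuple of behead t]))) /=.
  by apply: eq_bigr => t _; rewrite [in RHS](tuple_eta t).
exists (fun u : F * n.-tuple F => [tuple of u.1 :: u.2]) => [t _|[a t] _] /=.
  by rewrite -tuple_eta.
by congr pair; exact: val_inj.
Qed.

Lemma wavg_prod (R : realType) (F : finType) (a0 : F) n (f : nat -> F -> R) :
  wavg n (fun s => \prod_(i < n) f i (nth a0 s i)) =
  \prod_(i < n) (#|F|%:R^-1 * \sum_a f i a).
Proof.
elim: n f => [|n IHn] f; first by rewrite /= !big_ord0.
rewrite big_ord_recl -(IHn (fun i => f i.+1)) /= -mulrA; congr (_ * _).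
rewrite mulr_suml; apply: eq_bigr => a _.
by rewrite -wavgZ; apply: eq_wavg => s _; rewrite big_ord_recl.
Qed.

Section Digits.
Context {R : realType} {F : finType}.
Hypothesis F_gt0 : (0 < #|F|)%N.
Local Notation M := #|F|.
Implicit Types (w : R) (s : seq F).

(* The letters are the base-M digits of a uniform point of the unit interval. *)
Definition cell n w : nat := Num.truncn (M%:R ^+ n * w).

Definition digit i w : F := enum_val (Ordinal (ltn_pmod (cell i.+1 w) F_gt0)).

Definition word n w : n.-tuple F := [tuple of mkseq (digit^~ w) n].

Definition code s : nat := foldl (fun k a => k * M + enum_rank a)%N 0%N s.

Let M_gt0 : 0 < M%:R :> R. Proof. by rewrite ltr0n. Qed.

Lemma cell_div n w : 0 <= w -> cell n w = (cell n.+1 w %/ M)%N.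
Proof.
move=> w0; have Mw k : 0 <= M%:R ^+ k * w by rewrite mulr_ge0// exprn_ge0.
have /andP[lo hi] := truncn_itv (Mw n.+1); rewrite -/(cell n.+1 w) in lo hi.
apply/eqP; rewrite truncn_eq//; apply/andP; split.
  rewrite -(ler_pM2r M_gt0) -natrM mulrAC -exprSr; apply: le_trans lo.
  by rewrite ler_nat leq_trunc_div.
rewrite -(ltr_pM2r M_gt0) -natrM mulrAC -exprSr; apply: lt_le_trans hi _.
by rewrite ler_nat ltn_ceil.
Qed.

(** Spelling s means lying in the half-open interval of length M^-n numbered by the base-M value of
    s, which reduces the law of words to lengths of intervals. *)
Lemma word_code n w s : 0 <= w < 1 -> size s = n ->
  (word n w == s :> seq F) = (cell n w == code s).
Proof.
case/andP=> w0 w1; elim/last_ind: s n => [|s a IHs] n.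
  move=> <-; rewrite /cell expr0 mul1r /=; apply/esym/eqP.
  by apply/truncn0Pn; rewrite -ltNge.
rewrite size_rcons => <-; rewrite [LHS]/= /mkseq -addn1 iotaD map_cat cats1.
rewrite addn1 eqseq_rcons -[map _ _]/(val (word (size s) w)) IHs//.
rewrite (cell_div _ w0) /code foldl_rcons -/(code s).
rewrite /digit -(inj_eq enum_rank_inj) enum_valK -val_eqE /=.
have ea := ltn_ord (enum_rank a).
apply/andP/eqP => [[/eqP <- /eqP <-]|->]; first exact: divn_eq.
by rewrite divnMDl// divn_small// addn0 modnMDl modn_small.
Qed.

Lemma code_lt s : (code s < M ^ size s)%N.
Proof.
elim/last_ind: s => [|s a IHs]//; rewrite size_rcons /code foldl_rcons -/(code s).
rewrite expnSr (leq_trans (_ : _ < (code s).+1 * M)%N)//.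
  by rewrite mulSn addnC ltn_add2r ltn_ord.
by rewrite leq_mul2r IHs orbT.
Qed.

Local Notation T := (measurableTypeR R).
Definition unit_prob : probability T R := uniform_prob (@ltr01 R).

Lemma measurable_cell_gt n k : measurable [set w : T | (k < cell n w)%N].
Proof.
have -> : [set w : T | (k < cell n w)%N] = `[(k.+1%:R / M%:R ^+ n), +oo[.
  apply/seteqP; split=> w; rewrite /= in_itv/= andbT /cell truncn_gt_nat;
  by rewrite ler_pdivrMr ?exprn_gt0// mulrC.
exact: measurable_itv.
Qed.

Lemma measurable_cell n k : measurable [set w : T | cell n w = k].
Proof.
case: k => [|k].
  rewrite (_ : [set _ | _] = ~` [set w : T | (0 < cell n w)%N]).
    by apply: measurableC; exact: measurable_cell_gt.
  apply/seteqP; split=> w /=; first by move=> ->.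
  by move=> /negP; rewrite -eqn0Ngt => /eqP.
rewrite (_ : [set _ | _] = [set w : T | (k < cell n w)%N] `\`
    [set w : T | (k.+1 < cell n w)%N]).
  by apply: measurableD; exact: measurable_cell_gt.
apply/seteqP; split=> w /=; first by move=> ->; rewrite ltnn.
by move=> [kc /negP]; rewrite -leqNgt => ck; apply/eqP; rewrite eqn_leq ck.
Qed.

Lemma measurable_fibers_digit i : measurable_fibers (digit i : T -> F).
Proof.
move=> a; rewrite (_ : _ @^-1` _ =
  \bigcup_(k in [set k | (k %% M)%N = enum_rank a]) [set w : T | cell i.+1 w = k]).
  by apply: bigcup_measurable => k _; exact: measurable_cell.
apply/seteqP; split=> [w /= <-|w [k /= ka wk]].
  by exists (cell i.+1 w) => //=; rewrite /digit enum_valK.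
by rewrite /digit -[RHS]enum_rankK; congr enum_val; apply: val_inj; rewrite /= wk.
Qed.

Lemma measurable_fibers_word n : measurable_fibers (word n : T -> _).
Proof.
move=> t; rewrite (_ : _ @^-1` _ =
  \bigcap_(i in [set: 'I_n]) ((digit i : T -> F) @^-1` [set tnth t i])).
  apply: fin_bigcap_measurable; first exact: finite_finset.
  by move=> i _; exact: measurable_fibers_digit.
have wE w (i : 'I_n) : tnth (word n w) i = digit i w.
  by rewrite (tnth_nth (digit 0 w)) nth_mkseq.
apply/seteqP; split=> [w /= <- i _ /=|w wt]; first by rewrite wE.
by apply: eq_from_tnth => i; rewrite wE; exact: wt.
Qed.

(** The uniform law lives on the closed unit interval, whereas the digits are controlled on the
    half-open one; the endpoint 1 is null. *)
Lemma unit_prob_sub_itv (E : set T) (a b : R) : measurable E ->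
  0 <= a -> a <= b -> b <= 1 ->
  (forall w, 0 <= w < 1 -> E w <-> a <= w < b) ->
  unit_prob E = (b - a)%:E.
Proof.
move=> mE a0 ab b1 EP.
have mI : measurable (`[0, 1] : set T) by exact: measurable_itv.
have mab : measurable (`[a, b[ : set T) by exact: measurable_itv.
have -> : unit_prob E = lebesgue_measure (E `&` `[0, 1]).
  rewrite [LHS]integral_uniform_pdf.
  rewrite (eq_integral (fun=> 1%E)); last first.
    move=> x /set_mem[_]; rewrite /= in_itv/= /uniform_pdf => ->.
    by rewrite subr0 invr1.
  by rewrite integral_cst ?mul1e//; exact: measurableI.
have muab : (lebesgue_measure (`[a, b[ : set T) = (b - a)%:E :> \bar R)%E.
  rewrite lebesgue_measure_itv/= lte_fin; case: ltP => ab'; first by rewrite EFinB.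
  by rewrite (_ : b = a) ?subrr//; apply/eqP; rewrite eq_le ab'.
apply/eqP; rewrite eq_le -muab; apply/andP; split.
  apply: (@le_trans _ _ (lebesgue_measure ((`[a, b[ : set T) `|` [set 1%R]))).
    apply: le_measure.
    - by apply: mem_set; exact: measurableI.
    - by apply: mem_set; apply: measurableU => //; exact: measurable_set1.
    move=> w [Ew]; rewrite /= in_itv/= => /andP[w0].
    rewrite le_eqVlt => /predU1P[->|w1]; [by right|left].
    by rewrite /= in_itv/=; apply/EP => //; rewrite w0.
  apply: (le_trans (measureU2 _ mab (measurable_set1 1%R))).
  by rewrite [X in (_ + X)%E]lebesgue_measure_set1 adde0.
apply: le_measure.
- exact: mem_set.
- by apply: mem_set; exact: measurableI.
move=> w; rewrite /= !in_itv/= => /andP[aw wb].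
have w0 : 0 <= w by exact: le_trans aw.
have w1 : w < 1 by exact: lt_le_trans b1.
by split; [apply/EP; rewrite ?w0 ?aw|rewrite w0 ltW].
Qed.

Lemma mass_word n (t : n.-tuple F) : mass unit_prob (word n) t = M%:R ^- n.
Proof.
have Mn : 0 < M%:R ^+ n :> R by rewrite exprn_gt0.
have st : size t = n by rewrite size_tuple.
have kE : (code t)%:R / M%:R ^+ n <= (code t).+1%:R / M%:R ^+ n :> R.
  by rewrite ler_pM2r ?invr_gt0// ler_nat.
have lo : 0 <= (code t)%:R / M%:R ^+ n :> R by rewrite divr_ge0// ltW.
have hi : (code t).+1%:R / M%:R ^+ n <= 1 :> R.
  rewrite ler_pdivrMr// mul1r -natrX ler_nat.
  by have := code_lt t; rewrite st.
have mE := @measurable_fibers_word n t.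
rewrite /mass (unit_prob_sub_itv mE lo kE hi).
  by rewrite /= -mulrBl -natrB// subSnn mul1r.
move=> w w01; have := word_code w01 st.
have w0 : 0 <= M%:R ^+ n * w by rewrite mulr_ge0 ?(ltW Mn)//; case/andP: w01.
rewrite truncn_eq// ler_pdivrMr// ltr_pdivlMr// ![w * _]mulrC => <-.
by split => [->|/eqP/val_inj].
Qed.

Lemma prob_word n (g : pred (seq F)) :
  unit_prob [set w | g (word n w)] = (wavg n (fun s => (g s)%:R))%:E.
Proof.
rewrite (prob_fibers unit_prob (@measurable_fibers_word n) (fun t => g t)).
rewrite wavg_tuple mulr_sumr; congr EFin.
by apply: eq_bigr => t _; rewrite mass_word.
Qed.

Lemma prob_digits (J : seq nat) (A : nat -> pred F) : uniq J ->
  unit_prob (\bigcap_(i in [set` J]) (digit i @^-1` [set a | A i a])) =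
  (\prod_(i <- J) (M%:R^-1 * \sum_a (A i a)%:R))%:E.
Proof.
(* All positions in J fit into a word of length n, and each position outside J contributes the
   factor 1. *)
move=> uJ; pose n := (\max_(i <- J) i).+1.
have Jn i : i \in J -> (i < n)%N by move=> iJ; rewrite ltnS leq_bigmax_seq.
have a0 : F by exact: (enum_val (Ordinal F_gt0)).
pose f i a : R := if i \in J then (A i a)%:R else 1.
pose g s := all (fun i => A i (nth a0 s i)) J.
have -> : \bigcap_(i in [set` J]) (digit i @^-1` [set a | A i a]) =
    [set w | g (word n w)].
  apply/seteqP; split=> [w Jw|w /allP Jw i /= iJ].
    by apply/allP => i iJ; rewrite nth_mkseq ?Jn//; exact: Jw.
  by have := Jw i iJ; rewrite nth_mkseq ?Jn.
rewrite prob_word; congr EFin.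
have prodJ (G : nat -> R) :
    \prod_(i < n) (if (i : nat) \in J then G i else 1) = \prod_(i <- J) G i.
  rewrite -(big_mkord xpredT (fun i => if i \in J then G i else 1)).
  rewrite -big_mkcond/= -big_filter; apply: perm_big.
  apply: uniq_perm => //; first by rewrite filter_uniq// iota_uniq.
  move=> i; rewrite mem_filter mem_index_iota /=.
  by case: (boolP (i \in J)) => //= /Jn ->.
transitivity (wavg n (fun s => \prod_(i < n) f i (nth a0 s i))).
  apply: eq_wavg => s _; rewrite (prodJ (fun i => (A i (nth a0 s i))%:R)) /g.
  elim: J {uJ n Jn f g prodJ} => [|i J IHJ]; first by rewrite big_nil.
  by rewrite big_cons /= -IHJ -mulnb natrM.
rewrite wavg_prod -prodJ; apply: eq_bigr => i _.
rewrite /f; case: ifP => // _.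
by rewrite sumr_const mulVf// gt_eqF.
Qed.

Lemma mass_digit i a : mass unit_prob (digit i) a = M%:R^-1.
Proof.
have := @prob_digits [:: i] (fun _ => pred1 a) isT.
rewrite big_seq1 (bigD1 a)//= eqxx big1 ?addr0 ?mulr1 => [PE|b /negbTE ->]//.
rewrite /mass -[RHS]/(fine (M%:R^-1)%:E) -PE; congr (fine (unit_prob _)).
apply/seteqP; split=> w /=; first by move=> wa j; rewrite /= inE => /eqP ->; apply/eqP.
by move=> /(_ i); rewrite /= inE eqxx => /(_ isT)/eqP.
Qed.

(** The exit statements are about infinite independent sequences; the digits of a uniform point
    realize one on a concrete probability space. *)
Lemma iid_letters (B : completeNormedModType R) (y : F -> B) :
  iid_copies unit_prob (fun w => y (digit 0 w)) unit_prob
    (fun i w => y (digit i w)).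
Proof.
have single i (A : set B) : unit_prob ((fun w => y (digit i w)) @^-1` A) =
    (M%:R^-1 * \sum_a (`[< A (y a) >])%:R)%:E.
  have := @prob_digits [:: i] (fun _ a => `[< A (y a) >]) isT.
  rewrite big_seq1 => <-; congr (unit_prob _); apply/seteqP; split=> w /=.
    by move=> wA j; rewrite /= inE => /eqP ->; apply/asboolP.
  by move=> /(_ i); rewrite /= inE eqxx => /(_ isT)/asboolP.
split=> [j|j A _|J A uJ _].
- by case: (simple_element_fibers (measurable_fibers_digit j) y).
- by rewrite !single.
under eq_bigr do rewrite single.
rewrite -[LHS]/(unit_prob (\bigcap_(i in [set` J]) (digit i @^-1` [set a | A i (y a)]))).
transitivity ((\prod_(i <- J) (M%:R^-1 * \sum_a (`[< A i (y a) >])%:R))%:E : \bar R).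
  rewrite -(@prob_digits J (fun i a => `[< A i (y a) >]) uJ).
  congr (unit_prob _); apply: eq_bigcapr => i _; congr (_ @^-1` _).
  by apply/seteqP; split=> a /asboolP.
by elim/big_ind2 : _ => // ? u ? v <- <-; rewrite EFinM.
Qed.

End Digits.

(** * Exit times of random words *)

Section WordExit.
Context {R : realType} {B : completeNormedModType R} {F : finType}.
Hypothesis F_gt0 : (0 < #|F|)%N.
Variable y : F -> B.

Lemma survivesP d (T : measurableType d) (Xs : nat -> T -> B) (r : R) k w :
  survives Xs r k w <-> forall j, (1 <= j <= k)%N -> `|psum Xs j w| <= r.
Proof.
rewrite survivesE /=; split=> [/exit_time_leP nex j jk|small /exit_time_leP[j jk]].
  by rewrite leNgt; apply/negP => rj; apply: nex; exists j.
by rewrite ltNge small.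
Qed.

Lemma stayP (r : R) s : reflect
  (forall j, (1 <= j <= size s)%N -> `|\sum_(a <- take j s) y a| <= r)
  (stay y r 0 s).
Proof.
elim/last_ind: s => [|s a IHs].
  by apply: (iffP idP) => // _ [|j].
rewrite -cats1 stay_cat add0r /= andbT cats1; apply: (iffP andP).
  move=> [/IHs sr ar] j; rewrite size_rcons => /andP[j1].
  rewrite leq_eqVlt => /predU1P[->|].
    by rewrite -(size_rcons s a) take_size -cats1 big_cat big_seq1.
  rewrite ltnS => js; rewrite -cats1 takel_cat//.
  by apply: sr; rewrite j1.
move=> sr; split; last first.
  have := sr (size s).+1; rewrite size_rcons leqnn => /(_ isT).
  by rewrite -(size_rcons s a) take_size -cats1 big_cat big_seq1.
apply/IHs => j /andP[j1 js]; have := sr j; rewrite size_rcons j1 (leqW js).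
by rewrite -cats1 takel_cat// => /(_ isT).
Qed.

Let Xs i (w : measurableTypeR R) := y (digit F_gt0 i w).

Lemma psum_word j k (w : R) : (j <= k)%N ->
  psum Xs j w = \sum_(a <- take j (word F_gt0 k w)) y a.
Proof.
move=> jk; rewrite /= /mkseq -map_take take_iota (minn_idPl jk) big_map.
by rewrite /psum -(big_mkord xpredT (fun i => Xs i w)) /index_iota subn0.
Qed.

Lemma survives_word (r : R) k :
  survives Xs r k = [set w | stay y r 0 (word F_gt0 k w)].
Proof.
apply/seteqP; split=> w /=; rewrite survivesP.
  move=> small; apply/stayP => j; rewrite size_mkseq => /andP[j1 jk].
  by rewrite -psum_word// small// j1.
move=> /stayP small j /andP[j1 jk]; rewrite (psum_word w jk).
by apply: small; rewrite size_mkseq j1.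
Qed.

Lemma wavg_stay_le1 n (r : R) : wavg n (fun s => (stay y r 0 s)%:R) <= 1 :> R.
Proof.
rewrite -[leRHS](wavg_cst F_gt0 n); apply: wavg_le => s _.
by rewrite lern1 leq_b1.
Qed.

(** The finite form of E T_r P(T_{2r} <= m) <= m. Block i of m consecutive times contributes at most
    m q^i, and multiplying by 1 - q telescopes the geometric sum, without a division that would
    exclude q = 1. *)
Lemma sum_wavg_stay (r : R) m n : 0 <= r -> (1 <= m)%N ->
  (1 - wavg m (fun s => (stay y (2 * r) 0 s)%:R)) *
    \sum_(k < n) wavg k (fun s => (stay y r 0 s)%:R) <= m%:R :> R.
Proof.
move=> r0 m1; set q := wavg m _; pose a k : R := wavg k (fun s => (stay y r 0 s)%:R).
have a0 k : 0 <= a k by apply: wavg_ge0.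
have q0 : 0 <= q by apply: wavg_ge0.
have q1 : q <= 1 by exact: wavg_stay_le1.
have block j : \sum_(k < j * m) a k <= m%:R * \sum_(i < j) q ^+ i.
  elim: j => [|j IHj]; first by rewrite mul0n !big_ord0 mulr0.
  rewrite mulSnr big_split_ord big_ord_recr/= mulrDr lerD//.
  rewrite mulr_natl -[X in _ *+ X]card_ord -sumr_const ler_sum// => l _.
  apply: (le_trans (wavg_stay_cat y _ _ r0)).
  apply: (@le_trans _ _ (a (j * m)%N)); first by apply: ler_piMr; [exact: a0|exact: wavg_stay_le1].
  exact: wavg_stay_iter.
(* Since m >= 1, n blocks of length m cover the first n times. *)
have mono : \sum_(k < n) a k <= \sum_(k < n * m) a k.
  have -> : (n * m = n + n * m.-1)%N by rewrite -mulnS prednK.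
  by rewrite big_split_ord/= lerDl sumr_ge0.
apply: (@le_trans _ _ ((1 - q) * (m%:R * \sum_(i < n) q ^+ i))).
  by rewrite ler_wpM2l ?subr_ge0// (le_trans mono).
have := subrX1 q n; have : 0 <= q ^+ n by rewrite exprn_ge0.
have : 0 <= m%:R :> R by [].
move: (\sum_(i < n) _) (q ^+ n) (m%:R) => S p M M0 p0 E.
rewrite mulrCA (_ : (1 - q) * S = 1 - p); last by rewrite -opprB mulNr -E opprB.
by rewrite ler_piMr// gerBl.
Qed.

Variable e : nat -> B.
Hypothesis e_dense : forall b eps, 0 < eps -> exists j, `|b - e j| < eps.

Lemma mean_exit_time_word (r : R) m : 0 <= r -> (1 <= m)%N ->
  ((1 - wavg m (fun s => (stay y (2 * r) 0 s)%:R))%:E *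
    mean_exit_time unit_prob Xs r <= m%:R%:E)%E.
Proof.
move=> r0 m1; set q := wavg m _.
have [mXs _ _] := iid_letters F_gt0 y.
have q1 : q <= 1 by exact: wavg_stay_le1.
(* At q = 1 the mean may be infinite, and the product is 0 by convention. *)
have [->|qn1] := eqVneq q 1; first by rewrite subrr mul0e lee_fin.
have {q1 qn1}q1 : 0 < 1 - q by rewrite subr_gt0 lt_neqAle qn1.
rewrite -lee_pdivlMl// -EFinM (mean_exit_time_nneseries _ e_dense mXs).
apply: lime_le; first exact: is_cvg_nneseries.
near=> n; rewrite big_mkord.
rewrite (eq_bigr (fun k : 'I_n => (wavg k (fun s => (stay y r 0 s)%:R))%:E)).
  by rewrite sumEFin lee_fin mulrC ler_pdivlMr// mulrC sum_wavg_stay.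
move=> k _; rewrite survives_word.
exact: (prob_word F_gt0 k (fun s => stay y r 0 s)).
Unshelve. all: by end_near. Qed.

End WordExit.

(** * From the mean exit time back to type 2 *)

Section TypeTwoOfMeanBound.
Context {R : realType} {B : completeNormedModType R}.
Hypothesis B_sep : separable_space B.

Section LetterVariable.
Variables (N : nat) (x : 'I_N -> B).
Hypotheses (N_gt0 : (0 < N)%N) (x_neq0 : 0 < \sum_i `|x i| ^+ 2).
Local Notation letters_gt0 := (letters_gt0 N_gt0).

Let X (w : measurableTypeR R) := letter x (digit letters_gt0 0 w).

Lemma second_moment_letter : second_moment unit_prob X =
  (N%:R^-1 * \sum_i `|x i| ^+ 2)%:E.
Proof.
rewrite /second_moment expectationE.
rewrite (expectation_fibers unit_prob (measurable_fibers_digit letters_gt0 0)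
  (fun a => sqr_ge0 `|letter x a|)).
congr EFin; under eq_bigr do rewrite mass_digit normrZ normr_sign mul1r.
rewrite -(pair_bigA _ (fun i (b : bool) => _ * `|x i| ^+ 2))/=.
rewrite mulr_sumr; apply: eq_bigr => i _.
rewrite big_bool /= card_letters natrM; field.
by rewrite pnatr_eq0 -lt0n.
Qed.

Lemma has_expectation_letter : has_expectation unit_prob X 0.
Proof.
have := has_expectation_fibers unit_prob
  (measurable_fibers_digit letters_gt0 0) (letter x).
under eq_bigr do rewrite mass_digit.
rewrite -scaler_sumr -(pair_bigA _ (fun i (b : bool) => letter x (i, b)))/=.
rewrite big1 ?scaler0// => i _.
by rewrite big_bool /letter /= expr1 expr0 scaleN1r scale1r addNr.
Qed.

(** Every letter has positive mass, so an almost sure constant would equal all of them; then each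
    x_i equals its negative and vanishes. *)
Lemma nonconstant_letter : nonconstant unit_prob X.
Proof.
move=> [b [Z [mZ Z0 ZP]]].
have yb a : letter x a = b.
  apply/eqP/negPn/negP => /eqP ab.
  have : (unit_prob ((digit letters_gt0 0 : measurableTypeR R -> _) @^-1` [set a])
      <= unit_prob Z)%E.
    apply: le_measure; [|exact: mem_set|].
      by apply: mem_set; exact: measurable_fibers_digit.
    by move=> w /= wa; apply: ZP; rewrite /= /X wa.
  rewrite Z0 (massE unit_prob (measurable_fibers_digit letters_gt0 0)).
  rewrite mass_digit lee_fin leNgt invr_gt0 ltr0n.
  by rewrite letters_gt0.
move: x_neq0; rewrite big1 ?ltxx// => i _.
have := yb (i, true); rewrite -(yb (i, false)) /letter /= expr1 expr0.
rewrite scaleN1r scale1r => /eqP; rewrite -subr_eq0 -opprD oppr_eq0 -mulr2n.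
rewrite -scaler_nat scaler_eq0 pnatr_eq0 /= => /eqP ->.
by rewrite normr0 expr0n.
Qed.

Lemma in_L20_letter : in_L20 unit_prob X.
Proof.
split.
- split; last exact: nonconstant_letter.
  by have [+ _] := has_expectation_letter.
- by rewrite second_moment_letter ltry.
- exact: has_expectation_letter.
Qed.

Lemma exit_tails_of_mean_bound (c : R) : 0 < c ->
  exit_mean_asymptotic_bound B c -> exists r0, forall u n, r0 <= u -> (1 <= n)%N ->
    wavg n (fun s => (~~ stay (letter x) u 0 s)%:R)
    <= 8 * n%:R * (N%:R^-1 * \sum_i `|x i| ^+ 2) / (c * u ^+ 2).
Proof.
have [e [_ e_dense]] := separable_dense_seq B_sep.
move=> c0 H.
have := H _ _ _ _ _ _ _ _ in_L20_letter (iid_letters letters_gt0 (letter x)).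
rewrite second_moment_letter /=; set v := N%:R^-1 * _.
have v0 : 0 < v by rewrite mulr_gt0// invr_gt0 ltr0n.
(* Halving the constant gives a value strictly below the lower limit, attained beyond some radius M.
   Together with u = 2 r this makes the factor 2 * 4 = 8. *)
have cv : c / (2 * v) < c / v.
  have v2 : v < 2 * v by rewrite mulr_natl mulr2n ltrDl.
  by rewrite ltr_pM2l// ltf_pV2 ?posrE//; exact: lt_trans v2.
rewrite -lte_fin in cv; move=> /(lt_le_trans cv).
rewrite limf_einfE => /ereal_sup_gt[_ [W [M [_ MW]] <-] Wgt].
(* Then r = u / 2 is positive and exceeds M. *)
exists (2 * (`|M| + 1)) => u n Mu n1.
pose r := u / 2.
have uE : u = 2 * r by rewrite /r; field.
have Mr : M < r.
  rewrite (le_lt_trans (ler_norm M))// /r ltr_pdivlMr// mulrC.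
  by apply: lt_le_trans Mu; rewrite ltr_pM2l// ltrDl.
have r0 : 0 < r.
  by rewrite /r divr_gt0// (lt_le_trans _ Mu)// mulr_gt0// ltr_wpDl.
have low : ((c / (2 * v))%:E <= mean_exit_time unit_prob
    (fun i (w : measurableTypeR R) => letter x (digit letters_gt0 i w)) r * (r ^- 2)%:E)%E.
  by apply/ltW/(lt_le_trans Wgt); apply: ereal_inf_lbound; exists r => //; exact: MW.
have up := mean_exit_time_word letters_gt0 (letter x) e_dense (ltW r0) n1.
have r2 : 0 < r ^+ 2 by rewrite exprn_gt0.
rewrite -uE in up; set q := wavg n _ in up.
have -> : wavg n (fun s => (~~ stay (letter x) u 0 s)%:R) = 1 - q.
  rewrite -[X in X - q](wavg_cst letters_gt0 n 1) -wavgB; apply: eq_wavg => s _.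
  by case: (stay _ _ _ s) => /=; rewrite ?mulr0n ?mulr1n ?subrr ?subr0.
have q1 : 0 <= 1 - q by rewrite subr_ge0; exact: (wavg_stay_le1 letters_gt0).
have : ((1 - q)%:E * (c / (2 * v))%:E <= n%:R%:E * (r ^- 2)%:E)%E.
  apply: le_trans (lee_wpmul2l _ low) _; first by rewrite lee_fin.
  by rewrite muleA lee_wpmul2r// lee_fin invr_ge0 ltW.
rewrite -!EFinM lee_fin => qn.
have cu : 0 < c * u ^+ 2.
  by rewrite uE; apply: mulr_gt0 => //; apply: exprn_gt0; apply: mulr_gt0.
rewrite ler_pdivlMr// uE.
have : (1 - q) * (c / (2 * v)) * (8 * v * r ^+ 2) <= n%:R / r ^+ 2 * (8 * v * r ^+ 2).
  by apply: ler_wpM2r => //; apply: mulr_ge0; [apply: mulr_ge0|]; rewrite ?ltW.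
rewrite (_ : (1 - q) * (c / (2 * v)) * _ = (1 - q) * (c * (2 * r) ^+ 2)); last first.
  by field; rewrite gt_eqF.
move=> /le_trans; apply; apply/eqW.
by field; rewrite gt_eqF.
Qed.

End LetterVariable.

Lemma rademacher_of_mean_bound (c : R) : 0 < c ->
  exit_mean_asymptotic_bound B c -> forall N (x : 'I_N -> B),
  wavg N (fun s => `|signed_sum x s| ^+ 2) <= 2304 / c * \sum_i `|x i| ^+ 2.
Proof.
move=> c0 H [|N] x.
  by rewrite /= /signed_sum !big_ord0 normr0 expr0n mulr0.
have q0 : 0 <= \sum_i `|x i| ^+ 2 by apply: sumr_ge0 => i _; exact: sqr_ge0.
(* If all vectors vanish, the letter is degenerate and the exit bound does not apply to it. *)
have [qE|qn0] := eqVneq (\sum_i `|x i| ^+ 2) 0.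
  by rewrite qE mulr0 (wavg_signed_sum_eq0 qE).
have {qn0}q0 : 0 < \sum_i `|x i| ^+ 2 by rewrite lt_def qn0.
have [r0 tails] := exit_tails_of_mean_bound (ltn0Sn N) q0 c0 H.
exact: rademacher_of_exit_tails c0 q0 tails.
Qed.

Definition type2_const (c : R) : R := 16 * (2304 / c).

Lemma type2_of_mean_bound (c : R) : 0 < c ->
  exit_mean_asymptotic_bound B c -> type2 B (type2_const c).
Proof.
move=> c0 H; apply: (type2_of_rademacher B_sep).
  by apply: divr_ge0; [exact: ler0n|exact: ltW].
exact: rademacher_of_mean_bound.
Qed.

End TypeTwoOfMeanBound.

(** * The equivalence *)

Section Constants.
Context {R : realType}.
Implicit Types c k : R.

Definition prob_const c : R := 8 + 512 * c.

(** Every implication is routed through type 2, so five constants into it and five out of it replace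
    a table of pairs. They are defined before any space B is given and depend on c alone. *)
Definition to_type2 (i : nat) c : R :=
  match i with
  | 0 => c
  | 1 => type2_const (c / 2)
  | 2 => type2_const ((8 * c)^-1 / 2)
  | 3 => type2_const c
  | _ => type2_const (16 * c)^-1
  end.

Definition of_type2 (j : nat) c : R :=
  match j with
  | 0 => c
  | 1 => (8 * prob_const c)^-1
  | 2 => prob_const c
  | 3 => (8 * prob_const c)^-1 / 2
  | _ => 2 * prob_const c
  end.

Let natS_gt0 n : 0 < n.+1%:R :> R. Proof. by rewrite ltr0n. Qed.

Lemma half_gt0 c : 0 < c -> 0 < c / 2.
Proof. by move=> c0; apply: divr_gt0. Qed.

Lemma inv_mul_gt0 n c : 0 < c -> 0 < (n.+1%:R * c)^-1.
Proof. by move=> c0; rewrite invr_gt0; apply: mulr_gt0. Qed.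

Lemma type2_const_gt0 c : 0 < c -> 0 < type2_const c.
Proof. by move=> c0; apply: mulr_gt0; [exact: natS_gt0|apply: divr_gt0]. Qed.

Lemma prob_const_gt0 c : 0 < c -> 0 < prob_const c.
Proof.
by move=> c0; apply: addr_gt0; [exact: natS_gt0|apply: mulr_gt0].
Qed.

Lemma to_type2_gt0 i c : 0 < c -> 0 < to_type2 i c.
Proof.
move=> c0; case: i => [|[|[|[|i]]]]; rewrite /to_type2; first by [].
- exact/type2_const_gt0/half_gt0.
- exact/type2_const_gt0/half_gt0/inv_mul_gt0.
- exact: type2_const_gt0.
- exact/type2_const_gt0/inv_mul_gt0.
Qed.

Lemma of_type2_gt0 j c : 0 < c -> 0 < of_type2 j c.
Proof.
move=> c0; have k0 := prob_const_gt0 c0.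
case: j => [|[|[|[|j]]]]; rewrite /of_type2; first by [].
- exact: inv_mul_gt0.
- by [].
- exact/half_gt0/inv_mul_gt0.
- exact: mulr_gt0.
Qed.

Context {B : completeNormedModType R}.
Hypothesis B_sep : separable_space B.

Lemma type2_of_statement (i : 'I_5) c : 0 < c ->
  tnth (statements B) i c -> type2 B (to_type2 i c).
Proof.
move=> c0; rewrite (tnth_nth (type2 B)).
case: i => -[|[|[|[|[|i]]]]] i5; rewrite /to_type2 // => H.
- apply: (type2_of_mean_bound B_sep (half_gt0 c0)).
  exact: asymptotic_mean_of_mean_bound.
- have c8 := inv_mul_gt0 7 c0.
  apply: (type2_of_mean_bound B_sep (half_gt0 c8)).
  apply: (asymptotic_mean_of_mean_bound B_sep c8).
  exact: mean_bound_of_prob_bound.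
- exact: type2_of_mean_bound.
- apply: (type2_of_mean_bound B_sep (inv_mul_gt0 15 c0)).
  exact: asymptotic_mean_of_asymptotic_prob.
Qed.

Lemma statement_of_type2 (j : 'I_5) c : 0 < c ->
  type2 B c -> tnth (statements B) j (of_type2 j c).
Proof.
move=> c0 H; have k0 := prob_const_gt0 c0.
have P : exit_prob_bound B (prob_const c) by exact: prob_bound_of_type2.
rewrite (tnth_nth (type2 B)).
case: j => -[|[|[|[|[|j]]]]] j5; rewrite /of_type2 //.
- exact: mean_bound_of_prob_bound.
- apply: (asymptotic_mean_of_mean_bound B_sep (inv_mul_gt0 7 k0)).
  exact: mean_bound_of_prob_bound.
- exact: asymptotic_prob_of_prob_bound.
Qed.

End Constants.

Theorem theorem3p1 (R : realType) :
  (forall B : completeNormedModType R, separable_space B ->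
     [<-> exists2 c : R, 0 < c & type2 B c;
          exists2 c : R, 0 < c & exit_mean_bound B c;
          exists2 c : R, 0 < c & exit_prob_bound B c;
          exists2 c : R, 0 < c & exit_mean_asymptotic_bound B c;
          exists2 c : R, 0 < c & exit_prob_asymptotic_bound B c])
  /\
  (exists phi : 'I_5 -> 'I_5 -> R -> R,
     (forall (i j : 'I_5) (c : R), 0 < c -> 0 < phi i j c) /\
     (forall B : completeNormedModType R, separable_space B ->
        forall (i j : 'I_5) (c : R), 0 < c ->
          tnth (statements B) i c -> tnth (statements B) j (phi i j c))).
Proof.
have both (B : completeNormedModType R) (i j : 'I_5) (c : R) :
    separable_space B -> 0 < c -> tnth (statements B) i c ->
    tnth (statements B) j (of_type2 j (to_type2 i c)).
  move=> B_sep c0 /(type2_of_statement B_sep c0).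
  exact: statement_of_type2 (to_type2_gt0 i c0).
split; last first.
  exists (fun i j c => of_type2 j (to_type2 i c)); split=> [i j c c0|B B_sep i j c].
    exact/of_type2_gt0/to_type2_gt0.
  exact: both.
move=> B B_sep.
have step (i j : 'I_5) : (exists2 c : R, 0 < c & tnth (statements B) i c) ->
    exists2 c : R, 0 < c & tnth (statements B) j c.
  move=> [c c0 /(both B i j c B_sep c0) Hj].
  by exists (of_type2 j (to_type2 i c)) => //; exact/of_type2_gt0/to_type2_gt0.
pose o k (k5 : (k < 5)%N) : 'I_5 := Ordinal k5.
split; [|split; [|split; [|split]]].
- exact: (step (o 0 isT) (o 1 isT)).
- exact: (step (o 1 isT) (o 2 isT)).
- exact: (step (o 2 isT) (o 3 isT)).
- exact: (step (o 3 isT) (o 4 isT)).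
- exact: (step (o 4 isT) (o 0 isT)).
Qed.
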